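(* Let $\mathsf{M}=(E,\operatorname{rk})$ be a nonempty loopless polymatroid and $\mathcal{G}$ a building set on $\mathcal{L}(\mathsf{M})$. Then \[ \mathrm{H}_\mathsf{M}^{\mathcal{G}}(x) = \sum_{ S } \prod_{F\in S} \overline{\chi}_{\mathsf{M}|_{F}/\sup(S,F)}(x), \] where the sum runs over all spanning $\mathcal{G}$-nested sets $S$.
   Context: A polymatroid $\mathsf{M}=(E,\operatorname{rk})$: finite $E$, $\operatorname{rk}:2^E\to\mathbb{Z}_{\ge0}$ with $\operatorname{rk}(\varnothing)=0$, monotone and submodular. Flats: $F$ with $\operatorname{rk}(F\cup\{e\})>\operatorname{rk}(F)$ for all $e\notin F$; they form the lattice $\mathcal L(\mathsf{M})$ with join $\vee$; loopless means $\varnothing$ is a flat. $f(\mathcal{G})$ = inclusion-maximal elements of a set $\mathcal{G}$ of flats; $\mathcal{G}_{\le F}=\{G\in\mathcal{G}:G\subseteq F\}$. A building set is $\mathcal{G}\subseteq\mathcal L(\mathsf{M})\setminus\{\varnothing\}$ such that for every flat $F$ the map $\prod_{G\in f(\mathcal{G}_{\le F})}[\varnothing,G]\to[\varnothing,F]$, $(F_G)\mapsto\bigvee F_G$, is a lattice isomorphism and $\operatorname{rk}(F)=\sum_{G\in f(\mathcal{G}_{\le F})}\operatorname{rk}(G)$. A subset $S\subseteq\mathcal{G}$ is $\mathcal{G}$-nested if for every set $\{F_1,\dots,F_m\}\subseteq S$ of pairwise incomparable flats with $m\ge2$, the join $F_1\vee\cdots\vee F_m$ is not in $\mathcal{G}$;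 it is spanning if the join of all its elements is $E$. For $S\subseteq\mathcal{G}$ and $F\in\mathcal{G}$, $\sup(S,F)=\bigvee_{G\in S,\,G\subsetneq F}G$ (empty join $=\varnothing$). For flats $F\subsetneq G$, $\mathsf{M}|_G/F$ is the polymatroid on $G\setminus F$ with rank $A\mapsto\operatorname{rk}(A\cup F)-\operatorname{rk}(F)$. The characteristic polynomial is $\chi_\mathsf{M}(x)=\sum_{F\in\mathcal L(\mathsf{M})}\mu(\varnothing,F)x^{\operatorname{rk}(E)-\operatorname{rk}(F)}$ ($\mu$ the Möbius function), and for nonempty $\mathsf{M}$ the reduced characteristic polynomial is $\overline\chi_\mathsf{M}(x)=\chi_\mathsf{M}(x)/(x-1)$. The Chow ring $D(\mathsf{M},\mathcal{G})$ is $\mathbb{Q}[x_G:G\in\mathcal{G}]$ (degree-1 generators) modulo the ideal generated by $\big(\prod_{i=1}^m x_{G_i}\big)\big(\sum_{H\in\mathcal{G},H\supseteq G}x_H\big)^{\operatorname{rk}(G)-\operatorname{rk}(\sup(S,G))}$ for each subset $S=\{G_1,\dots,G_m\}\subseteq\mathcal{G}$ and $G\in\mathcal{G}$; $\mathrm{H}_\mathsf{M}^{\mathcal{G}}(x)=\sum_i\dim D^i(\mathsf{M},\mathcal{G})x^i$ is its Hilbert series. *)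

(* Defs.v *)
From HB Require Import structures.
From mathcomp Require Import all_boot all_order all_algebra.
From mathcomp.multinomials Require Import mpoly.

Set Implicit Arguments.
Unset Strict Implicit.
Unset Printing Implicit Defensive.

Import GRing.Theory.
Local Open Scope ring_scope.

Record polymatroid (E : finType) := Polymatroid {
  rk : {set E} -> nat;
  rk_set0 : rk set0 = 0%N;
  rk_mono : forall A B : {set E}, A \subset B -> (rk A <= rk B)%N;
  rk_submod : forall A B : {set E},
    (rk (A :|: B) + rk (A :&: B) <= rk A + rk B)%N
}.

Section Flats.
Variables (E : finType) (M : polymatroid E).
Implicit Types (A F : {set E}) (S G : {set {set E}}).

Definition flat F : bool := [forall e, (e \notin F) ==> (rk M F < rk M (e |: F))%N].

Definition loopless : bool := flat set0.

(* Flats are closed under intersection, so this is the least flat containing A. *)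
Definition cl A : {set E} := \bigcap_(F : {set E} | flat F && (A \subset F)) F.

Definition join S : {set E} := cl (\bigcup_(F in S) F).

Definition lower_interval F : {set {set E}} := [set X | flat X & X \subset F].

Definition maximal_elements G : {set {set E}} :=
  [set X | maxset (fun Y => Y \in G) X].

Definition factors G F : {set {set E}} :=
  maximal_elements [set X in G | X \subset F].

(* An element of the product of the intervals [set0, X], for X in factors G F, *)
(* is encoded as a finite function on all sets, equal to set0 off factors G F. *)
Definition factor_tuples G F : {pred {ffun {set E} -> {set E}}} :=
  pfamily set0 (factors G F) lower_interval.

Definition factor_join G F (phi : {ffun {set E} -> {set E}}) : {set E} :=
  join [set phi X | X in factors G F].

(* The meet of two flats is their intersection, and meets and joins in the *)
(* product lattice are computed componentwise.                             *)
Definition factor_join_iso G F : Prop :=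
  [/\ [set factor_join G F phi | phi in factor_tuples G F] = lower_interval F,
      {in factor_tuples G F &, injective (factor_join G F)},
      {in factor_tuples G F &, forall phi psi : {ffun {set E} -> {set E}},
         factor_join G F [ffun X => join [set phi X; psi X]]
         = join [set factor_join G F phi; factor_join G F psi]}
    & {in factor_tuples G F &, forall phi psi : {ffun {set E} -> {set E}},
         factor_join G F [ffun X => phi X :&: psi X]
         = factor_join G F phi :&: factor_join G F psi}].

Definition building_set G : Prop :=
  (forall X, X \in G -> flat X /\ X != set0) /\
  (forall F, flat F ->
     factor_join_iso G F /\ rk M F = (\sum_(X in factors G F) rk M X)%N).

Definition incomparable (X Y : {set E}) : bool :=
  ~~ (X \subset Y) && ~~ (Y \subset X).

Definition antichain S : bool :=
  [forall X in S, forall Y in S, (X != Y) ==> incomparable X Y].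

Definition nested G S : bool :=
  (S \subset G) &&
  [forall A : {set {set E}},
     [&& A \subset S, (2 <= #|A|)%N & antichain A] ==> (join A \notin G)].

Definition spanning S : bool := join S == [set: E].

Definition sup_below S F : {set E} := join [set X in S | X \proper F].

(* The Moebius function of the poset of flats; the fuel n only has to bound *)
(* the length of chains, see mobiusE.                                       *)
Fixpoint mobius_rec (n : nat) (F H : {set E}) : int :=
  if F == H then 1 else
  if n is n'.+1 then
    - \sum_(K : {set E} | [&& flat K, F \subset K & K \proper H]) mobius_rec n' F K
  else 0.

Definition mobius (F H : {set E}) : int := mobius_rec #|H| F H.

Definition characteristic_poly : {poly int} :=
  \sum_(F : {set E} | flat F) mobius set0 F *: 'X^(rk M [set: E] - rk M F).

(* The divisor is monic, so this is Euclidean division in int[X]; it is exact *)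
(* for loopless polymatroids on a nonempty ground set, see reduced_charP.     *)
Definition reduced_characteristic_poly : {poly int} := characteristic_poly %/ ('X - 1).

Lemma mobius_recE n F (H : {set E}) : (#|H| <= n)%N -> mobius_rec n F H = mobius F H.
Proof.
rewrite /mobius; move: {2}#|H| (leqnn #|H|) => k leHk lekn.
elim: k n F H leHk lekn => [|k IHk] n F H leHk leHn.
  have H0 : H = set0 by apply/eqP; rewrite -cards_eq0 -leqn0.
  rewrite H0 cards0; case: n {leHn} => //= n; case: eqP => // _.
  by rewrite big_pred0 ?oppr0 // => K; rewrite /proper sub0set !andbF.
case cH: #|H| leHk leHn => [|h] leHk leHn.
  have H0 : H = set0 by apply/eqP; rewrite -cards_eq0 cH.
  rewrite H0; case: n {leHn} => //= n; case: eqP => // _.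
  by rewrite big_pred0 ?oppr0 // => K; rewrite /proper sub0set !andbF.
case: n leHn => // n leHn /=; case: eqP => // _; congr (- _).
apply: eq_bigr => K /and3P[_ _ /proper_card]; rewrite cH ltnS => leKh.
by rewrite !IHk // (leq_trans leKh).
Qed.

Lemma mobiusE F (H : {set E}) : mobius F H =
  if F == H then 1 else
  - \sum_(K : {set E} | [&& flat K, F \subset K & K \proper H]) mobius F K.
Proof.
rewrite -(@mobius_recE #|H|.+1) //=; case: eqP => // _; congr (- _).
by apply: eq_bigr => K /and3P[_ _ /proper_card /ltnW]; apply: mobius_recE.
Qed.

Lemma reduced_charP : (0 < #|E|)%N -> loopless ->
  characteristic_poly = reduced_characteristic_poly * ('X - 1).
Proof.
move=> E_gt0 ll; have flatT : flat [set: E].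
  by apply/forallP => e; rewrite in_setT.
have : root characteristic_poly 1.
  rewrite /root /characteristic_poly horner_sum.
  under eq_bigr do rewrite hornerZ hornerXn expr1n mulr1.
  have /negPf ET : set0 != [set: E] by rewrite eq_sym -cards_eq0 cardsT -lt0n.
  rewrite (bigD1 [set: E]) //= mobiusE ET addrC subr_eq0.
  by apply/eqP; apply: eq_bigl => K; rewrite sub0set properT.
move/factor_theorem => [q]; rewrite polyC1 /reduced_characteristic_poly => ->.
by rewrite Pdiv.IdomainMonic.mulpK // -[1]/(1%:P) monicXsubC.
Qed.

End Flats.

Section Minor.
Variables (E : finType) (M : polymatroid E) (G F : {set E}).

Let ground := {x : E | x \in G :\: F}.

Definition minor_rk (A : {set ground}) : nat :=
  (rk M ((val @: A) :|: F) - rk M F)%N.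

Fact minor_rk_set0 : minor_rk set0 = 0%N.
Proof. by rewrite /minor_rk imset0 set0U subnn. Qed.

Fact minor_rk_mono (A B : {set ground}) :
  A \subset B -> (minor_rk A <= minor_rk B)%N.
Proof. by move=> sAB; rewrite leq_sub2r // rk_mono // setSU // imsetS. Qed.

Fact minor_rk_submod (A B : {set ground}) :
  (minor_rk (A :|: B) + minor_rk (A :&: B) <= minor_rk A + minor_rk B)%N.
Proof.
rewrite /minor_rk imsetU imsetI; last by move=> x y _ _; apply: val_inj.
have rkF C : (rk M F <= rk M (C :|: F))%N by rewrite rk_mono ?subsetUr.
have:= rk_submod M (val @: A :|: F) (val @: B :|: F).
rewrite setUACA setUid -setUIl => le.
rewrite !addnBA ?addnBAC ?rkF // leq_sub2r ?leq_sub2r //.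
Qed.

(* The polymatroid M|_G/F. *)
Definition minor : polymatroid {x : E | x \in G :\: F} :=
  Polymatroid minor_rk_set0 minor_rk_mono minor_rk_submod.

End Minor.

Section ChowRing.
Variables (E : finType) (M : polymatroid E) (G : {set {set E}}).

(* The variable 'X_i stands for x_H, where H = enum_val i. *)
Local Notation A := {mpoly rat[#|G|]}.

Definition chow_generator (S : {set {set E}}) (F : {set E}) : A :=
  (\prod_(i < #|G| | enum_val i \in S) 'X_i) *
  (\sum_(i < #|G| | F \subset enum_val i) 'X_i) ^+ (rk M F - rk M (sup_below M S F)).

Definition chow_ideal (p : A) : Prop :=
  exists c : {set {set E}} -> {set E} -> A,
    p = \sum_(S : {set {set E}} | S \subset G) \sum_(F in G)
          c S F * chow_generator S F.

(* The degree d part of the quotient of A by chow_ideal has dimension k: the *)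
(* classes of some k forms of degree d are a basis of it over the rationals. *)
Definition chow_dim (d k : nat) : Prop :=
  exists b : 'I_k -> A,
    [/\ forall j, b j \is d.-homog,
        forall p : A, p \is d.-homog ->
          exists c : 'I_k -> rat, chow_ideal (p - \sum_j c j *: b j)
      & forall c : 'I_k -> rat,
          chow_ideal (\sum_j c j *: b j) -> forall j, c j = 0].

(* H is the coefficient sequence of the Hilbert series of the Chow ring. *)
Definition hilbert_series (H : nat -> nat) : Prop :=
  forall d, chow_dim d (H d).

Lemma chow_idealD p q : chow_ideal p -> chow_ideal q -> chow_ideal (p + q).
Proof.
move=> [c ->] [c' ->]; exists (fun S F => c S F + c' S F).
rewrite -big_split; apply: eq_bigr => S _; rewrite -big_split.
by apply: eq_bigr => F _; rewrite mulrDl.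
Qed.

Lemma chow_idealZ a p : chow_ideal p -> chow_ideal (a *: p).
Proof.
move=> [c ->]; exists (fun S F => a *: c S F).
rewrite scaler_sumr; apply: eq_bigr => S _; rewrite scaler_sumr.
by apply: eq_bigr => F _; rewrite scalerAl.
Qed.

Lemma chow_ideal0 : chow_ideal 0.
Proof.
by exists (fun _ _ => 0); rewrite big1 // => S _; rewrite big1 // => F _; rewrite mul0r.
Qed.

Lemma chow_ideal_sum I (r : seq I) (f : I -> A) :
  (forall i, chow_ideal (f i)) -> chow_ideal (\sum_(i <- r) f i).
Proof.
by move=> If; elim/big_rec: _ => [|i p _ Ip];
  [apply: chow_ideal0 | apply: chow_idealD].
Qed.

Lemma chow_dim_le d k l : chow_dim d k -> chow_dim d l -> (k <= l)%N.
Proof.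
move=> [b [homb _ freeb]] [b' [_ spanb' _]]; rewrite leqNgt; apply/negP => ltlk.
have [f fP] : exists f : 'I_k -> 'I_l -> rat,
    forall j, chow_ideal (b j - \sum_i f j i *: b' i).
  by have [f fP] := fin_all_exists (fun j => spanb' _ (homb j)); exists f.
pose B : 'M[rat]_(k, l) := \matrix_(j, i) f j i.
have /rowV0Pn[v /sub_kermxP vB v0] : kermx B != 0.
  by rewrite kermx_eq0 /row_free neq_ltn (leq_ltn_trans (rank_leq_col B)).
have Iv : chow_ideal (\sum_j v 0 j *: b j).
  have -> : \sum_j v 0 j *: b j =
            \sum_j v 0 j *: (b j - \sum_i f j i *: b' i).
    rewrite -[LHS]subr0; under [RHS]eq_bigr do rewrite scalerBr.
    rewrite big_split /= sumrN; congr (_ - _).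
    under eq_bigr do rewrite scaler_sumr.
    rewrite exchange_big big1 // => i _.
    under eq_bigr do rewrite scalerA.
    rewrite -scaler_suml.
    have /matrixP/(_ 0 i) := vB; rewrite !mxE.
    by under eq_bigr do rewrite mxE; move=> ->; rewrite scale0r.
  by apply: chow_ideal_sum => j; apply: chow_idealZ.
case/negP: v0; apply/eqP/rowP => j; rewrite mxE.
exact: (freeb (fun j => v 0 j) Iv).
Qed.

Lemma chow_dim_unique d k l : chow_dim d k -> chow_dim d l -> k = l.
Proof. by move=> dk dl; apply/eqP; rewrite eqn_leq !(@chow_dim_le d). Qed.

End ChowRing.

(* Main.v *)
Require Import Defs.
From HB Require Import structures.
From mathcomp Require Import all_boot all_order all_algebra.
From mathcomp Require Import zify.
From mathcomp.multinomials Require Import mpoly.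

Set Implicit Arguments.
Unset Strict Implicit.
Unset Printing Implicit Defensive.

Import GRing.Theory.
Local Open Scope ring_scope.

(** Hilbert series. Adjoin the elements of the building set one at a time, larger
    flats first. If U is an up-closed part of the building set and F is maximal
    outside U, then setting x_F = t presents the Chow-type ring of U + F as
    R[t] / (t K, (t + y)^c), where y is the sum of the x_H over H > F, the
    quotient R/K is the ring of U in which F has been prescribed as an element of
    the nested set, and y^c K = 0 in R. As in Keel's formula for the Chow ring of
    a blow-up, R[t] / (t K, (t + y)^c) is R plus c - 1 shifted copies of R/K.
    Hence the Chow ring has a monomial basis with generating function
      sum over nested S of the product over F in S of
        x + ... + x^(rk F - rk (sup (S, F)) - 1).

    Identity. Let N(L) be the part of this sum with all elements of S below the
    flat L, and N'(L) the analogous sum of products of reduced characteristic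
    polynomials over the nested S with join L. Both are multiplicative over the
    factors of L. If C is in the building set and N0(J) is the part of N with
    join J, then N(C) is the sum over J < C of N0(J) (1 + x + ... + x^(rk C - rk J - 1)).
    By Moebius inversion the bracket is the sum over J <= K < C of the reduced
    characteristic polynomials of the intervals [K, C], so that N(C) is
    the sum over K < C of those polynomials times N(K), which is the recursion
    satisfied by N'. *)

(** * Polynomials viewed in one distinguished variable over the others *)

Section IsolateVariable.
Variables (n : nat) (R : comNzRingType) (f : 'I_n).
Local Notation A := {mpoly R[n]}.
Implicit Types (m : 'X_{1..n}) (p q : A).

Definition isolate_image (i : 'I_n) : {poly A} :=
  if i == f then 'X else ('X_i)%:P.

Fact isolate_key : unit. Proof. exact: tt. Qed.

(* Locked: otherwise unification unfolds the sum over the support. *)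
Definition isolate : A -> {poly A} :=
  locked_with isolate_key (mmap (polyC \o @mpolyC n R) isolate_image).

Fact isolate_is_additive : additive isolate.
Proof. by rewrite /isolate unlock; apply: mmap_is_additive. Qed.
Fact isolate_is_multiplicative : multiplicative isolate.
Proof. by rewrite /isolate unlock; apply: mmap_is_multiplicative. Qed.
HB.instance Definition _ :=
  GRing.isAdditive.Build A {poly A} isolate isolate_is_additive.
HB.instance Definition _ :=
  GRing.isMultiplicative.Build A {poly A} isolate isolate_is_multiplicative.

Lemma isolateD p q : isolate (p + q) = isolate p + isolate q.
Proof. exact: rmorphD. Qed.

Lemma isolateB p q : isolate (p - q) = isolate p - isolate q.
Proof. exact: rmorphB. Qed.

Lemma isolateM p q : isolate (p * q) = isolate p * isolate q.
Proof. exact: rmorphM. Qed.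

Definition mnm_clear (m : 'X_{1..n}) : 'X_{1..n} :=
  [multinom if i == f then 0%N else m i | i < n].

Lemma mnm_clearK m : m = (mnm_clear m + U_(f) *+ m f)%MM.
Proof.
apply/mnmP => i; rewrite mnmDE mulmnE mnm1E mnmE (eq_sym f).
by case: eqVneq => [->|_]; rewrite ?mul1n ?mul0n ?addn0.
Qed.

Lemma mnm_clear_eq m : m f = 0%N -> mnm_clear m = m.
Proof. by move=> m0; rewrite [in RHS](mnm_clearK m) m0 mulm0n addm0. Qed.

Lemma mnm_clearf m : mnm_clear m f = 0%N.
Proof. by rewrite mnmE eqxx. Qed.

Lemma isolateX i : isolate 'X_i = isolate_image i.
Proof. by rewrite /isolate unlock mmapX mmap1U. Qed.

Lemma isolateC (c : R) : isolate c%:MP = (c%:MP)%:P.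
Proof. by rewrite /isolate unlock; apply: mmapC. Qed.

Lemma isolateXm m : isolate 'X_[m] = ('X_[mnm_clear m])%:P * 'X^(m f).
Proof.
rewrite /isolate unlock mmapX /mmap1 (bigD1 f) //= /isolate_image eqxx mulrC.
congr (_ * _); rewrite [in RHS]mpolyXE_id rmorph_prod [RHS](bigD1 f) //=.
rewrite mnm_clearf expr0 mul1r; apply: eq_bigr => i /negPf nif.
by rewrite nif mnmE nif rmorphXn.
Qed.

(** A left inverse of [isolate], which is therefore injective: a polynomial vanishes as soon as all
    coefficients of its image do. *)
Lemma isolate_horner p : (isolate p).['X_f] = p.
Proof.
elim/mpolyind: p => [|c m p _ _ IHp]; first by rewrite rmorph0 horner0.
rewrite isolateD hornerD.
rewrite IHp -mul_mpolyC.
rewrite isolateM isolateC isolateXm.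
rewrite hornerM hornerC hornerM.
rewrite hornerC hornerXn.
by rewrite mpolyXn -mpolyXD -mnm_clearK.
Qed.

Lemma mcoeff_isolate p k m :
  ((isolate p)`_k)@_m = if m f == 0%N then p@_(m + U_(f) *+ k)%MM else 0.
Proof.
elim/mpolyind: p => [|c m' p _ _ IHp]; first by rewrite rmorph0 coef0 !mcoeff0 if_same.
rewrite isolateD coefD mcoeffD IHp -mul_mpolyC isolateM isolateC isolateXm.
rewrite mulrA -polyCM coefCM coefXn.
rewrite mcoeffD; set a := (_ * _)@_m; set b := (_ * 'X_[m'])@__.
suff -> : a = if m f == 0%N then b else 0 by case: ifP; rewrite ?addr0.
rewrite {}/a {}/b -mulrA !mcoeffCM.
case: (k =P m' f) => [->|neq].
  rewrite mulr1 !mcoeffX; case: ifPn => [/eqP mf0|mf].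
    congr (_ * _%:R); congr nat_of_bool; apply/eqP/eqP => [<-|]; first by rewrite -mnm_clearK.
    by move=> e; have := mnm_clearK m'; rewrite {1}e => /addIm.
  case: eqP => [e|_]; last by rewrite mulr0.
  by rewrite -e mnm_clearf in mf.
rewrite mulr0 mcoeff0 mulr0; case: ifP => // /eqP mf.
rewrite mcoeffX; case: eqP => [e|_]; last by rewrite mulr0.
by case: neq; rewrite e mnmDE mf mulmnE mnm1E eqxx mul1n.
Qed.

End IsolateVariable.

(** * Towers of blow-ups *)

(* In the application ['I_n] indexes a building set and [D S j] is the number *)
(* rk F_j - rk (sup (S, F_j)).                                                *)
Section Tower.
Variables (n : nat) (R : comNzRingType).
Variables (le : rel 'I_n) (D : {set 'I_n} -> 'I_n -> nat).
Local Notation A := {mpoly R[n]}.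
Implicit Types (p q r : A) (U W S T : {set 'I_n}) (f h i j k : 'I_n).

Let lt i j := (i != j) && le i j.

Hypothesis le_refl : reflexive le.
Hypothesis le_anti : antisymmetric le.
Hypothesis le_trans : transitive le.
Hypothesis D_anti : forall S T j, S \subset T -> (D T j <= D S j)%N.
Hypothesis D_local : forall S T j,
  (forall i, lt i j -> (i \in S) = (i \in T)) -> D S j = D T j.
(** The trace of submodularity of the rank: inserting [f] lowers the exponent at a larger [h] by at
    most the exponent of [f] itself. *)
Hypothesis D_add : forall W S f h, W \subset S -> lt f h ->
  (D S h <= D (f |: S) h + D W f)%N.
Hypothesis D_lt : forall S f k h, lt f k -> lt k h ->
  (D (k |: S) h <= D (f |: S) h)%N.
(** In a building set, two elements with a common lower bound have their join in the building set;
    [j] is that join. *)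
Hypothesis D_join : forall f h k, lt f h -> lt f k -> ~~ le h k -> ~~ le k h ->
  exists j, [/\ le h j, le k j,
     (forall i, le h i -> le k i -> le j i),
     (forall S, (D (k |: S) j <= D (f |: S) h)%N) & D [set h; k] j = 0%N].

Definition xprod S : A := \prod_(i in S) 'X_i.
Definition ysum h : A := \sum_(i | le h i) 'X_i.
Definition ysum_above f : A := \sum_(i | lt f i) 'X_i.

(* [U] is the set of elements blown up so far; the elements of [W] are not *)
(* variables, but count as members of the nested set.                      *)
Inductive tower_ideal U W : A -> Prop :=
| TowerZero : tower_ideal U W 0
| TowerAdd p q : tower_ideal U W p -> tower_ideal U W q -> tower_ideal U W (p + q)
| TowerMul a p : tower_ideal U W p -> tower_ideal U W (a * p)
| TowerVar i : i \notin U -> tower_ideal U W 'X_i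
| TowerGen S h : h \in U -> tower_ideal U W (xprod S * ysum h ^+ D (S :|: W) h).
Local Notation J := tower_ideal.

Lemma tower_idealMr U W a p : J U W p -> J U W (p * a).
Proof. by rewrite mulrC; apply: TowerMul. Qed.

Lemma tower_idealN U W p : J U W p -> J U W (- p).
Proof. by rewrite -mulN1r; apply: TowerMul. Qed.

Lemma tower_ideal_sum (I : Type) (s : seq I) (P : pred I) (F : I -> A) U W :
  (forall i : I, P i -> J U W (F i)) -> J U W (\sum_(i <- s | P i) F i).
Proof.
by move=> JF; apply: big_rec => [|i p /JF Ji Jp]; [apply: TowerZero | apply: TowerAdd].
Qed.

Lemma tower_ideal_gen U W S h e : h \in U -> (D (S :|: W) h <= e)%N ->
  J U W (xprod S * ysum h ^+ e).
Proof.
move=> hU /subnKC <-; rewrite exprD mulrA; apply: tower_idealMr.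
exact: TowerGen.
Qed.

Lemma tower_idealS U W W' p : W \subset W' -> J U W p -> J U W' p.
Proof.
move=> sW; elim=> {p} [|p q _ Jp _ Jq|a p _ Jp|i iU|S h hU].
- exact: TowerZero.
- exact: TowerAdd.
- exact: TowerMul.
- exact: TowerVar.
- by apply: tower_ideal_gen => //; apply: D_anti; apply: setUS.
Qed.

(** Products over sets are squarefree, so a cofactor ['X_i] is left over when [i] already lies in
    [S]; otherwise the cofactor is 1. *)
Lemma xprodU1 i S : exists a, 'X_i * xprod S = a * xprod (i |: S).
Proof.
have [iS|iS] := boolP (i \in S); last by exists 1; rewrite mul1r /xprod big_setU1.
by exists 'X_i; congr (_ * xprod _); apply/setP => j; rewrite !inE; case: eqP => // ->.
Qed.

Lemma tower_ideal_exp U W a b p c :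
  J U W ((a - b) * p) -> J U W ((a ^+ c - b ^+ c) * p).
Proof. by move=> Jp; rewrite subrXX mulrAC; apply: tower_idealMr. Qed.

Definition spanned U W (s : seq 'X_{1..n}) (d : nat) p : Prop :=
  exists r, [/\ r \is d.-homog, {subset msupp r <= s} & J U W (p - r)].

(** The remainder in [spanned] has the degree of the given form, and the last clause is linear
    independence modulo the ideal; so [s], sorted by degree, gives a basis of every graded piece. *)
Definition monomial_basis U W (s : seq 'X_{1..n}) : Prop :=
  [/\ uniq s,
      forall m : 'X_{1..n}, m \in s -> forall i, i \notin U -> m i = 0%N,
      forall d p, p \is d.-homog -> spanned U W s d p
    & forall p, {subset msupp p <= s} -> J U W p -> p = 0].

Lemma spannedD U W s d p q :
  spanned U W s d p -> spanned U W s d q -> spanned U W s d (p + q).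
Proof.
move=> [r [hr sr Jr]] [r' [hr' sr' Jr']]; exists (r + r'); split.
- exact: dhomogD.
- by move=> m /msuppD_le; rewrite mem_cat => /orP[/sr|/sr'].
- by rewrite opprD addrACA; apply: TowerAdd.
Qed.

Lemma spannedZ U W s d a p : spanned U W s d p -> spanned U W s d (a *: p).
Proof.
move=> [r [hr sr Jr]]; exists (a *: r); split; first exact: dhomogZ.
  by move=> m /msuppZ_le /sr.
by rewrite -scalerBr -mul_mpolyC; apply: TowerMul.
Qed.

Lemma spanned_ideal U W s d p : J U W p -> spanned U W s d p.
Proof.
by move=> Jp; exists 0; rewrite subr0 msupp0; split=> //; apply: dhomog0.
Qed.

Lemma spanned_sum (I : Type) (t : seq I) (P : pred I) (F : I -> A) U W s d :
  (forall i : I, P i -> spanned U W s d (F i)) ->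
  spanned U W s d (\sum_(i <- t | P i) F i).
Proof.
move=> SF; apply: big_rec => [|i p /SF]; last exact: spannedD.
by apply: spanned_ideal; apply: TowerZero.
Qed.

(** * A single blow-up *)

Section Step.
Variables (U : {set 'I_n}) (f : 'I_n).
Hypothesis U_up : forall i j, i \in U -> le i j -> j \in U.
Hypothesis fU : f \notin U.
Hypothesis f_up : forall i, lt f i -> i \in U.

Lemma lt_le_trans i j k : lt i j -> le j k -> lt i k.
Proof.
move=> /andP[nij ij] jk; apply/andP; split; last exact: le_trans ij jk.
by apply: contraNneq nij => ik; apply/eqP/le_anti; rewrite ij ik.
Qed.

Lemma ysum_split h k : le h k ->
  ysum h - ysum k = \sum_(i | le h i && ~~ le k i) 'X_i.
Proof.
move=> hk; rewrite /ysum (bigID (le k)) /= addrC.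
rewrite [X in _ + X - _](eq_bigl (le k)) ?addrK // => i.
by apply: andb_idl; apply: le_trans.
Qed.

Lemma ysum_above_split h : lt f h ->
  ysum_above f - ysum h = \sum_(i | lt f i && ~~ le h i) 'X_i.
Proof.
move=> fh; rewrite /ysum_above (bigID (le h)) /= addrC.
rewrite [X in _ + X - _](eq_bigl (le h)) ?addrK // => i.
by apply: andb_idl; apply: lt_le_trans.
Qed.

(** For the join [j] of [h] and [k], the generator attached to [[set h; k]] and [j] has exponent 0,
    so it is the monomial itself. *)
Lemma tower_ideal_incomparable W h k : lt f h -> lt f k -> ~~ le h k -> ~~ le k h ->
  J U W ('X_h * 'X_k).
Proof.
move=> fh fk nhk nkh; have [j [hj _ _ _ D0]] := D_join fh fk nhk nkh.
have hk : h != k by apply: contraNneq nhk => ->.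
have -> : 'X_h * 'X_k = xprod [set h; k] * ysum j ^+ 0 :> A.
  by rewrite /xprod big_setU1 ?inE // big_set1 expr0 mulr1.
apply: tower_ideal_gen; first by apply: f_up; apply: lt_le_trans hj.
by rewrite -D0 D_anti ?subsetUl.
Qed.

(* If [h] and [k] are incomparable, then modulo the ideal [ysum h] may be    *)
(* replaced by [ysum j], where [j] is their join; [D_join] bounds the exponent. *)
Lemma tower_ideal_var W S h k : lt f h -> lt f k -> ~~ le h k ->
  J U W ('X_k * (xprod S * ysum h ^+ D (S :|: (f |: W)) h)).
Proof.
move=> fh fk nhk; have hU := f_up fh.
have Dk T : (k |: S) :|: T = k |: (S :|: T) by rewrite setUA.
have Df T : S :|: (f |: T) = f |: (S :|: T) by rewrite setUCA.
have [kh|nkh] := boolP (le k h).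
  have ltkh : lt k h by rewrite /lt kh andbT; apply: contraNneq nhk => ->.
  rewrite mulrA; have [a ->] := xprodU1 k S; rewrite -mulrA; apply: TowerMul.
  by apply: tower_ideal_gen => //; rewrite Dk Df D_lt.
have [j [hj kj lub Dj _]] := D_join fh fk nhk nkh; set e := D _ h.
have jU : j \in U := U_up hU hj.
have Jj : J U W ('X_k * (xprod S * ysum j ^+ e)).
  rewrite mulrA; have [a ->] := xprodU1 k S; rewrite -mulrA; apply: TowerMul.
  by apply: tower_ideal_gen => //; rewrite Dk /e Df Dj.
(* The difference of [ysum h] and [ysum j] is a sum of variables ['X_i] with [i] above [h] but not
   above [j]. Such an [i] is incomparable with [k], so ['X_i * 'X_k] is in the ideal. *)
have JB : J U W ((ysum h ^+ e - ysum j ^+ e) * ('X_k * xprod S)).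
  apply: tower_ideal_exp; rewrite ysum_split // mulr_suml.
  apply: tower_ideal_sum => i /andP[hi nji]; rewrite mulrA; apply: tower_idealMr.
  apply: tower_ideal_incomparable => //; first exact: lt_le_trans hi.
    by apply: contra nhk => ik; apply: le_trans ik.
  by apply: contra nji; apply: lub.
rewrite mulrA mulrC -(subrK (ysum j ^+ e) (ysum h ^+ e)) mulrDl.
by apply: TowerAdd => //; rewrite mulrC -mulrA.
Qed.

(** This is y^c K = 0 in R. For a generator at [h] above [f], y^c may be replaced by [ysum h ^+ c]:
    the difference is a multiple of a sum of ['X_k] covered by [tower_ideal_var]. The exponents then
    add up to enough by [D_add]. For any other [h], prescribing [f] does not change the exponent. *)
Lemma tower_ideal_annihilated W p : J U (f |: W) p -> J U W (ysum_above f ^+ D W f * p).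
Proof.
elim=> {p} [|p q _ Jp _ Jq|a p _ Jp|i iU|S h hU].
- by rewrite mulr0; apply: TowerZero.
- by rewrite mulrDr; apply: TowerAdd.
- by rewrite mulrCA; apply: TowerMul.
- by apply: TowerMul; apply: TowerVar.
have Df : S :|: (f |: W) = f |: (S :|: W) by rewrite setUCA.
have [fh|nfh] := boolP (lt f h); last first.
  apply: TowerMul; rewrite (@D_local _ (S :|: W)); first exact: TowerGen.
  by move=> i ih; rewrite Df !inE; case: eqP => [ei|//]; rewrite -ei ih in nfh.
set e := D _ h; set c := D W f; set t := xprod S * _.
rewrite -(subrK (ysum h ^+ c) (ysum_above f ^+ c)) mulrDl; apply: TowerAdd.
  apply: tower_ideal_exp; rewrite ysum_above_split // mulr_suml.
  by apply: tower_ideal_sum => k /andP[fk nhk]; apply: tower_ideal_var.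
rewrite mulrCA -exprD; apply: tower_ideal_gen => //.
by rewrite /e Df addnC D_add ?subsetUr.
Qed.

Local Notation phi := (@isolate n R f).
Local Notation X_f := ('X_f : A).

Lemma isolate_xprod S : f \notin S -> phi (xprod S) = (xprod S)%:P.
Proof.
move=> fS; rewrite /xprod !rmorph_prod; apply: eq_bigr => i iS /=.
by rewrite isolateX /isolate_image; case: eqP => // ei; rewrite -ei iS in fS.
Qed.

Lemma isolate_sum (P : pred 'I_n) : ~~ P f ->
  phi (\sum_(i | P i) 'X_i) = (\sum_(i | P i) 'X_i)%:P.
Proof.
move=> Pf; rewrite !rmorph_sum; apply: eq_bigr => i Pi /=.
by rewrite isolateX /isolate_image; case: eqP => // ei; rewrite -ei Pi in Pf.
Qed.

Lemma isolate_ysum h : h \in U -> phi (ysum h) = (ysum h)%:P.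
Proof. by move=> hU; apply: isolate_sum; apply: contra fU; apply: U_up. Qed.

Lemma isolate_ysum_above : phi (ysum_above f) = (ysum_above f)%:P.
Proof. by apply: isolate_sum; rewrite /lt eqxx. Qed.

Lemma ysumE : ysum f = X_f + ysum_above f.
Proof.
rewrite /ysum (bigD1 f) //=; congr (_ + _); apply: eq_bigl => i.
by rewrite /lt eq_sym andbC.
Qed.

Definition center_poly (c : nat) : {poly A} := ('X + (ysum_above f)%:P) ^+ c.

Lemma isolate_ysum_f c : phi (ysum f ^+ c) = center_poly c.
Proof.
rewrite rmorphXn /= ysumE isolateD isolateX isolate_ysum_above.
by rewrite /isolate_image eqxx.
Qed.

Lemma center_poly_monic c : center_poly c \is monic.
Proof.
rewrite /center_poly -[(ysum_above f)%:P]opprK -polyCN.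
by rewrite monic_exp ?monicXsubC.
Qed.

Lemma size_center_poly c : size (center_poly c) = c.+1.
Proof.
rewrite /center_poly -[(ysum_above f)%:P]opprK -polyCN.
elim: c => [|c IHc]; first by rewrite expr0 size_poly1.
by rewrite exprS size_monicM ?monicXsubC ?size_XsubC ?IHc // -size_poly_eq0 IHc.
Qed.

Lemma center_poly0 c : (center_poly c)`_0 = ysum_above f ^+ c.
Proof.
by rewrite -horner_coef0 /center_poly horner_exp hornerD hornerX hornerC add0r.
Qed.

Variable W : {set 'I_n}.
Let c := D W f.
Local Notation I := (J U W).
Local Notation K := (J U (f |: W)).

Let I_sub_K p : I p -> K p.
Proof. by apply: tower_idealS; apply: subsetUr. Qed.

(** The ideal of [{poly A}] generated by I, t K and (t + y)^c: the polynomials [u] with these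
    coefficient conditions form I + t K[t], because I is contained in K. *)
Definition blowup_member (w : {poly A}) : Prop := exists u q : {poly A},
  [/\ w = u + center_poly c * q, I u`_0 & forall i : nat, K u`_i].

(** As [U] is up-closed and misses [f], no element of [S] lies strictly below [f]. *)
Lemma D_minimal S : S \subset f |: U -> D (S :|: W) f = c.
Proof.
move=> sS; apply: D_local => i /andP[nif lif]; rewrite inE.
case iS: (i \in S) => //=; have := subsetP sS _ iS; rewrite !inE (negPf nif) /=.
by move=> iU; case/negP: fU; apply: U_up lif.
Qed.

Lemma blowup_memberD v w :
  blowup_member v -> blowup_member w -> blowup_member (v + w).
Proof.
move=> [u [q [-> Iu Ku]]] [u' [q' [-> Iu' Ku']]].
exists (u + u'), (q + q'); split; first by rewrite mulrDr addrACA.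
  by rewrite coefD; apply: TowerAdd.
by move=> i; rewrite coefD; apply: TowerAdd.
Qed.

Lemma blowup_memberM a w : blowup_member w -> blowup_member (a * w).
Proof.
move=> [u [q [-> Iu Ku]]]; exists (a * u), (a * q); split.
- by rewrite mulrDr mulrCA.
- by rewrite coef0M; apply: TowerMul.
- by move=> i; rewrite coefM; apply: tower_ideal_sum => k _; apply: TowerMul.
Qed.

Lemma blowup_memberC p : I p -> blowup_member p%:P.
Proof.
move=> Ip; exists p%:P, 0; split; first by rewrite mulr0 addr0.
  by rewrite coefC.
by move=> i; rewrite coefC; case: eqP => _; [apply: I_sub_K | apply: TowerZero].
Qed.

Lemma blowup_memberXC p : K p -> blowup_member ('X * p%:P).
Proof.
move=> Kp; exists ('X * p%:P), 0; split; first by rewrite mulr0 addr0.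
  by rewrite coefXM; apply: TowerZero.
move=> i; rewrite coefXM; case: eqP => _; first exact: TowerZero.
by rewrite coefC; case: eqP => _ //; apply: TowerZero.
Qed.

(** The generators at [f] give multiples of (t + y)^c. Those at [h] in [U] land in I if [f] is not
    in [S]; otherwise one factor t splits off and [f] moves from [S] to the prescribed set, which
    gives an element of t K. *)
Lemma blowup_member_isolate p : J (f |: U) W p -> blowup_member (phi p).
Proof.
have var i : i \notin f |: U -> blowup_member (phi 'X_i).
  rewrite !inE negb_or isolateX /isolate_image => /andP[/negPf-> iU].
  by apply: blowup_memberC; apply: TowerVar.
elim=> {p} [|p q _ Bp _ Bq|a p _ Bp|i|S h].
- by rewrite rmorph0 -polyC0; apply: blowup_memberC; apply: TowerZero.
- by rewrite isolateD; apply: blowup_memberD.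
- by rewrite isolateM; apply: blowup_memberM.
- exact: var.
have [sS|/subsetPn[i iS iU] _] := boolP (S \subset f |: U); last first.
  rewrite /xprod (bigD1 i) //= -mulrA mulrC isolateM.
  by apply: blowup_memberM; apply: var.
rewrite !inE => /orP[/eqP->|hU].
  rewrite D_minimal // isolateM isolate_ysum_f mulrC.
  exists 0, (phi (xprod S)); rewrite add0r coef0; split=> // [|i]; rewrite ?coef0;
    exact: TowerZero.
have yE e : phi (ysum h ^+ e) = (ysum h ^+ e)%:P.
  by rewrite !rmorphXn /= isolate_ysum.
have [fS|fS] := boolP (f \in S); last first.
  rewrite isolateM yE isolate_xprod // -polyCM; apply: blowup_memberC.
  exact: TowerGen.
have -> : S :|: W = (S :\ f) :|: (f |: W).
  by apply/setP => i; rewrite !inE; case: eqP => //= ->; rewrite fS.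
rewrite isolateM yE.
have -> : xprod S = X_f * xprod (S :\ f) by rewrite /xprod (big_setD1 f).
rewrite isolateM isolateX /isolate_image eqxx isolate_xprod ?setD11 //.
by rewrite -mulrA -polyCM; apply: blowup_memberXC; apply: TowerGen.
Qed.

(* Modulo [K] a multiple of a monic polynomial of degree [c] has degree at *)
(* least [c] unless it vanishes.                                           *)
Lemma blowup_quotient (w u q : {poly A}) : w = u + center_poly c * q ->
  (size w <= c)%N -> (forall i : nat, K u`_i) -> forall i : nat, K q`_i.
Proof.
move=> wE szw Ku; move: {2}(size q) (leqnn (size q)) => N leN.
(* Descending induction on [i], phrased as induction on [N - i]. *)
suff H (k i : nat) : (N - i <= k)%N -> K q`_i by move=> i; apply: (H (N - i)%N).
elim: k i => [|k IHk] i leNi.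
  rewrite nth_default; first exact: TowerZero.
  by rewrite (leq_trans leN) // -subn_eq0 -leqn0.
have [leNi0|ltiN] := leqP N i.
  by rewrite nth_default ?(leq_trans leN) //; apply: TowerZero.
have /(congr1 (fun v : {poly A} => v`_(i + c))) := wE.
rewrite coefD nth_default ?(leq_trans szw) ?leq_addl // coefM => /eqP.
have ltc : (c < (i + c).+1)%N by rewrite ltnS leq_addl.
rewrite (bigD1 (Ordinal ltc)) //= addnK.
have := center_poly_monic c; rewrite monicE lead_coefE size_center_poly /=.
move=> /eqP-> ; rewrite mul1r addrCA eq_sym addr_eq0 => /eqP->.
apply: tower_idealN; apply: TowerAdd => //.
apply: tower_ideal_sum => l nl; have := ltn_ord l; rewrite ltnS => lel.
have [ltlc|lecl|elc] := ltngtP l c; last by case/eqP: nl; apply: val_inj.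
  apply: TowerMul; apply: IHk; rewrite leq_subLR.
  rewrite leq_subLR addnS -addSn in leNi.
  rewrite (leq_trans leNi) // leq_add2r -addnBA ?(ltnW ltlc) //.
  by rewrite -[X in (X <= _)%N]addn1 leq_add2l subn_gt0.
by rewrite nth_default ?mul0r ?size_center_poly //; apply: TowerZero.
Qed.

(** Below degree c in t the relation (t + y)^c adds nothing to I + t K[t]. The quotient [q] has
    coefficients in K, and its contribution to the constant term, a multiple of y^c by an element of
    K, falls into I. *)
Lemma blowup_member_coef w : blowup_member w -> (size w <= c)%N ->
  I w`_0 /\ forall i : nat, K w`_i.
Proof.
move=> [u [q [wE Iu Ku]]] szw; have Kq := blowup_quotient wE szw Ku.
rewrite wE; split=> [|i]; rewrite coefD; apply: TowerAdd => //.
  by rewrite coef0M center_poly0; apply: tower_ideal_annihilated.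
by rewrite coefM; apply: tower_ideal_sum => k _; apply: TowerMul.
Qed.

(** Since [f] is not in [U], the ideal I contains ['X_f], which need not belong to the larger
    tower's ideal. Hence the lift is made after setting ['X_f] to 0, that is, after taking the
    constant coefficient. *)
Lemma isolate0_lift p : I p -> J (f |: U) W (phi p)`_0.
Proof.
elim=> {p} [|p q _ Jp _ Jq|a p _ Jp|i iU|S h hU].
- by rewrite rmorph0 coef0; apply: TowerZero.
- by rewrite isolateD coefD; apply: TowerAdd.
- by rewrite isolateM coef0M; apply: TowerMul.
- rewrite isolateX /isolate_image; case: eqVneq => [_|nif].
    by rewrite coefX; apply: TowerZero.
  by rewrite coefC; apply: TowerVar; rewrite !inE negb_or nif.
rewrite isolateM rmorphXn /= isolate_ysum // coef0M -rmorphXn coefC /=.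
have [fS|fS] := boolP (f \in S); last first.
  by rewrite isolate_xprod // coefC; apply: TowerGen; rewrite inE hU orbT.
rewrite /xprod (big_setD1 f) //= isolateM coef0M isolateX /isolate_image eqxx.
by rewrite coefX !mul0r; apply: TowerZero.
Qed.

(** The factor ['X_f] turns the prescribed element [f] into a genuine member of the set [S] of a
    generator. *)
Lemma isolate0_liftX p : K p -> J (f |: U) W (X_f * (phi p)`_0).
Proof.
elim=> {p} [|p q _ Jp _ Jq|a p _ Jp|i iU|S h hU].
- by rewrite rmorph0 coef0 mulr0; apply: TowerZero.
- by rewrite isolateD coefD mulrDr; apply: TowerAdd.
- by rewrite isolateM coef0M mulrCA; apply: TowerMul.
- rewrite isolateX /isolate_image; case: eqVneq => [_|nif].
    by rewrite coefX mulr0; apply: TowerZero.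
  by rewrite coefC; apply: TowerMul; apply: TowerVar; rewrite !inE negb_or nif.
rewrite isolateM rmorphXn /= isolate_ysum // coef0M -rmorphXn coefC /=.
have [fS|fS] := boolP (f \in S); last first.
  rewrite isolate_xprod // coefC mulrA.
  have -> : X_f * xprod S = xprod (f |: S) by rewrite /xprod big_setU1.
  by rewrite setUCA setUA; apply: TowerGen; rewrite inE hU orbT.
rewrite /xprod (big_setD1 f) //= isolateM coef0M isolateX /isolate_image eqxx.
by rewrite coefX !mul0r mulr0; apply: TowerZero.
Qed.

Variables sI sK : seq 'X_{1..n}.
Hypothesis c_gt0 : (0 < c)%N.
Hypothesis sI_basis : monomial_basis U W sI.
Hypothesis sK_basis : monomial_basis U (f |: W) sK.

(** The list [iota 1 c.-1] is 1, ..., c - 1: a basis of R is followed by c - 1 shifted copies of a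
    basis of R/K. *)
Definition blowup_basis : seq 'X_{1..n} :=
  sI ++ [seq (m + U_(f) *+ l)%MM | l <- iota 1 c.-1, m <- sK].

Let sI0 (m : 'X_{1..n}) : m \in sI -> m f = 0%N.
Proof. by case: sI_basis => _ sI0 _ _ /sI0; apply. Qed.

Let sK0 (m : 'X_{1..n}) : m \in sK -> m f = 0%N.
Proof. by case: sK_basis => _ sK0 _ _ /sK0; apply. Qed.

Let shift_f (m : 'X_{1..n}) (l : nat) : m f = 0%N -> (m + U_(f) *+ l)%MM f = l.
Proof. by move=> m0; rewrite mnmDE mulmnE mnm1E eqxx m0 mul1n. Qed.

Let blowup_basis_shift (m : 'X_{1..n}) (l : nat) : m f = 0%N ->
  ((m + U_(f) *+ l)%MM \in blowup_basis) =
  if l == 0%N then m \in sI else (l < c)%N && (m \in sK).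
Proof.
move=> m0; rewrite mem_cat; case: eqP => [->|/eqP l0].
  rewrite mulm0n addm0 orbC; case: allpairsP => // -[[l' m']] /= [].
  rewrite mem_iota => /andP[l'0 _] /sK0 m'0 mE.
  by move: m0 l'0; rewrite mE shift_f // => ->.
have -> : (m + U_(f) *+ l)%MM \in sI = false.
  by apply/negP => /sI0; rewrite shift_f // => e; rewrite e in l0.
apply/allpairsP/andP => [[[l' m']] /= []|[lc mK]].
  rewrite mem_iota add1n prednK // => /andP[_ lc] mK e.
  have el := congr1 (fun m : 'X_{1..n} => m f) e.
  rewrite /= (shift_f _ m0) (shift_f _ (sK0 mK)) in el.
  by move: e; rewrite el => /addIm->.
by exists (l, m); rewrite /= mem_iota add1n prednK // lt0n l0.
Qed.

Lemma blowup_basis_uniq : uniq blowup_basis.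
Proof.
case: sI_basis => uI _ _ _; case: sK_basis => uK _ _ _.
rewrite cat_uniq uI /=; apply/andP; split.
  apply/hasPn => m /allpairsP[[l m']] /= [].
  rewrite mem_iota => /andP[l0 _] /sK0 m'0 ->; apply/negP => /sI0.
  by rewrite shift_f // => e; rewrite e in l0.
apply: allpairs_uniq => //; first exact: iota_uniq.
move=> x y /allpairsP[[l m] /= [_ mK ->]] /allpairsP[[l' m'] /= [_ mK' ->]] /= e.
have el := congr1 (fun m : 'X_{1..n} => m f) e; rewrite /= !shift_f ?sK0 // in el.
by move: e; rewrite el => /addIm->.
Qed.

Lemma blowup_basis_support (m : 'X_{1..n}) :
  m \in blowup_basis -> forall i, i \notin f |: U -> m i = 0%N.
Proof.
rewrite mem_cat => mB i; rewrite !inE negb_or => /andP[nif iU].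
case/orP: mB => [mI|/allpairsP[[l m'] /= [_ mK ->]]].
  by case: sI_basis => _ s0 _ _; apply: s0 mI i iU.
rewrite mnmDE mulmnE mnm1E eq_sym (negPf nif) mul0n addn0.
by case: sK_basis => _ s0 _ _; apply: s0 mK i iU.
Qed.

Lemma isolate_support r :
  (forall m, m \in msupp r -> m f = 0%N) -> phi r = r%:P.
Proof.
move=> r0; apply/polyP => k; apply/mpolyP => m; rewrite mcoeff_isolate coefC.
case: ifPn => [/eqP m0|m0].
  case: k => [|k] /=; first by rewrite mulm0n addm0.
  rewrite mcoeff0; apply/eqP; rewrite mcoeff_eq0; apply/negP => /r0.
  by rewrite shift_f.
case: k => [|k] /=; rewrite ?mcoeff0 //; apply/esym/eqP; rewrite mcoeff_eq0.
by apply: contra m0 => /r0 ->.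
Qed.

Lemma isolate0B q r : phi q = q%:P -> phi r = r%:P -> (phi (q - r))`_0 = q - r.
Proof.
move=> fq fr; have -> : phi (q - r) = (q - r)%:P.
  by rewrite isolateB fq fr -polyCB.
by rewrite coefC eqxx.
Qed.

(** Strong induction on [l]. The bases of R and of R/K settle [l = 0] and [0 < l < c]; for larger
    [l] the relation [ysum f ^+ c] trades [X_f ^+ l] for lower powers. *)
Lemma blowup_basis_span_power (l e : nat) q :
  phi q = q%:P -> q \is e.-homog ->
  spanned (f |: U) W blowup_basis (l + e) (X_f ^+ l * q).
Proof.
elim/ltn_ind: l e q => l IHl e q fq hq.
have [lc|cl] := ltnP l c.
  case: (posnP l) => [->|l0].
    rewrite expr0 mul1r add0n; case: sI_basis => _ _ spI _.
    have [r [hr sr Jr]] := spI _ _ hq; exists r; split=> //.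
      by move=> m /sr; rewrite mem_cat => ->.
    have fr : phi r = r%:P by apply: isolate_support => m /sr /sI0.
    by have := isolate0_lift Jr; rewrite isolate0B.
  case: sK_basis => _ _ spK _; have [r [hr sr Jr]] := spK _ _ hq.
  exists (X_f ^+ l * r); split.
  - by apply: dhomogM => //; rewrite mpolyXn dhomogX /= mdegMn mdeg1 mul1n.
  - move=> m; rewrite mpolyXn mulrC (perm_mem (msuppMX _ _)) => /mapP[m' /sr mK ->].
    by rewrite addmC blowup_basis_shift ?sK0 // lc mK (gtn_eqF l0).
  - have fr : phi r = r%:P by apply: isolate_support => m /sr /sK0.
    have := isolate0_liftX Jr; rewrite isolate0B // => JX.
    by rewrite -mulrBr -(prednK l0) exprSr -mulrA; apply: TowerMul.
have Jc : J (f |: U) W (X_f ^+ (l - c) * (ysum f ^+ c) * q).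
  apply: tower_idealMr; apply: TowerMul; rewrite -[_ ^+ c]mul1r.
  have -> : 1 = xprod set0 by rewrite /xprod big_set0.
  by apply: tower_ideal_gen; rewrite ?setU11 ?set0U.
(* The leading term of the binomial expansion is split off; [T] collects the terms with fewer
   factors [X_f]. *)
rewrite ysumE exprDn big_ord_recl subn0 expr0 mulr1 bin0 mulr1n in Jc.
rewrite mulrDr -exprD subnK // mulrDl mulr_sumr mulr_suml in Jc.
set T := \sum_(_ < _) _ in Jc; rewrite -[_ * q](addrK T).
apply: spannedD; first exact: spanned_ideal.
rewrite -scaleN1r; apply: spannedZ; apply: spanned_sum => i _.
rewrite mulrnAr mulrnAl -scaler_nat; apply: spannedZ.
rewrite /= /bump /= add1n mulrA -exprD -mulrA.
have ic : (i < c)%N := ltn_ord i.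
have -> : (l - c + (c - i.+1) = l - i.+1)%N by rewrite addnBA // subnK.
have -> : (l + e = (l - i.+1) + (i.+1 + e))%N.
  by rewrite addnA subnK // (leq_trans ic).
apply: IHl; first by rewrite ltn_subrL /= (leq_trans c_gt0 cl).
  by rewrite isolateM rmorphXn /= isolate_ysum_above fq -rmorphXn -polyCM.
apply: dhomogM => //; have hy : ysum_above f \is 1.-homog.
  by apply: rpred_sum => k _; rewrite dhomogX /= mdeg1.
by have := dhomogMn i.+1 hy; rewrite mul1n.
Qed.

Lemma blowup_basis_span (d : nat) p :
  p \is d.-homog -> spanned (f |: U) W blowup_basis d p.
Proof.
move=> /dhomogP hp; rewrite [p]mpolyE big_seq; apply: spanned_sum => m mp.
apply: spannedZ; rewrite {1}(mnm_clearK f m) mpolyXD mulrC -mpolyXn.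
have mE := congr1 (@mdeg n) (mnm_clearK f m).
rewrite mdegD mdegMn mdeg1 mul1n addnC in mE.
rewrite -(hp _ mp) /= mE; apply: blowup_basis_span_power.
  by rewrite isolateXm mnm_clearf expr0 mulr1 mnm_clear_eq // mnm_clearf.
by rewrite dhomogX.
Qed.

(** The image of [p] has degree below c in t, so its constant coefficient is in I and the others are
    in K. Each is a combination of basis monomials modulo the respective ideal, hence zero. *)
Lemma blowup_basis_free p :
  {subset msupp p <= blowup_basis} -> J (f |: U) W p -> p = 0.
Proof.
move=> sp Jp; case: sI_basis => _ _ _ freeI; case: sK_basis => _ _ _ freeK.
have supp (k : nat) (m : 'X_{1..n}) : m \in msupp (phi p)`_k ->
    if k == 0%N then m \in sI else (k < c)%N && (m \in sK).
  rewrite mcoeff_msupp mcoeff_isolate; case: ifPn => [/eqP m0|]; last by rewrite eqxx.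
  by rewrite -mcoeff_msupp => /sp; rewrite blowup_basis_shift.
have szw : (size (phi p) <= c)%N.
  apply/leq_sizeP => k ck; apply/mpolyP => m; rewrite mcoeff0.
  apply/eqP; rewrite mcoeff_eq0; apply/negP => /supp.
  by rewrite ltnNge ck /=; case: eqP => // k0; rewrite k0 leqNgt c_gt0 in ck.
have [I0 Kk] := blowup_member_coef (blowup_member_isolate Jp) szw.
suff w0 : phi p = 0 by rewrite -(isolate_horner f p) w0 horner0.
apply/polyP => -[|k]; rewrite coef0.
  by apply: freeI => // m /supp.
by apply: freeK => // m /supp /= /andP[].
Qed.

Lemma blowup_basisP : monomial_basis (f |: U) W blowup_basis.
Proof.
split; [exact: blowup_basis_uniq | exact: blowup_basis_support
       | exact: blowup_basis_span | exact: blowup_basis_free].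
Qed.

End Step.

(** * Hilbert series of a tower *)

Definition truncated_geometric (c : nat) : {poly int} := \sum_(1 <= l < c) 'X^l.

(** Nonvanishing of all exponents is the abstract form of nestedness: for a building set, exponent 0
    at [h] says that the chosen elements strictly below [h] have join [h]. The elements of [W]
    influence exponents but contribute no factor. *)
Definition tower_hilbert U W : {poly int} :=
  \sum_(S : {set 'I_n} | (S \subset U) && [forall h in U, D (S :|: W) h != 0%N])
     \prod_(f in S) truncated_geometric (D (S :|: W) f).

Lemma tower_hilbert0 W : tower_hilbert set0 W = 1.
Proof.
rewrite /tower_hilbert (big_pred1 set0) ?big_set0 // => S.
rewrite subset0 /=; case: eqP => //= ->.
by apply/forallP => h; rewrite inE.
Qed.

Lemma tower_hilbert_null U W f : f \in U -> D W f = 0%N -> tower_hilbert U W = 0.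
Proof.
move=> fU D0; apply: big_pred0 => S; apply/negP => /andP[_ /forall_inP/(_ f fU)].
by rewrite -lt0n ltnNge -D0 D_anti ?subsetUr.
Qed.

(** The sum splits by whether [f] belongs to [S]. By minimality the exponent at [f] is [D W f] in
    both cases; when [f] is in [S], it contributes its factor and is then counted in [W]. *)
Lemma tower_hilbertU1 U W f :
  (forall i j, i \in U -> le i j -> j \in U) -> f \notin U -> (0 < D W f)%N ->
  tower_hilbert (f |: U) W =
  tower_hilbert U W + truncated_geometric (D W f) * tower_hilbert U (f |: W).
Proof.
move=> U_up fU c_gt0.
have Dmin := D_minimal U_up fU W.
have cond S : S \subset f |: U -> [forall h in f |: U, D (S :|: W) h != 0%N] =
    [forall h in U, D (S :|: W) h != 0%N].
  move=> sS; apply/forall_inP/forall_inP => H h; first by move=> hU; rewrite H ?setU1r.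
  by rewrite !inE => /orP[/eqP->|/H //]; rewrite Dmin // -lt0n.
have U1K : (f |: U) :\ f = U by rewrite setU1K.
rewrite /tower_hilbert (bigID (fun S : {set 'I_n} => f \notin S)) /=; congr (_ + _).
  apply: eq_bigl => S; rewrite -{3}U1K subsetD1.
  by case sS: (S \subset f |: U) => //=; rewrite cond // andbC.
rewrite (reindex_onto (fun S => f |: S) (fun S => S :\ f)) /=; last first.
  by move=> S /andP[_]; rewrite negbK => fS; rewrite setD1K.
rewrite mulr_sumr; apply: eq_big => [S|S].
  rewrite negbK setU11 andbT.
  have -> : ((f |: S) :\ f == S) = (f \notin S).
    apply/eqP/idP => [<-|fS]; first by rewrite setD11.
    by rewrite setU1K.
  have -> : (S \subset U) = (S \subset f |: U) && (f \notin S).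
    by rewrite -subsetD1 U1K.
  have [sS|nsS] := boolP (S \subset f |: U); last first.
    by rewrite subUset (negPf nsS) andbF.
  have sfS : f |: S \subset f |: U by rewrite subUset sub1set setU11.
  by rewrite sfS cond //= andbC; congr (_ && _); rewrite setUCA setUA.
move=> /andP[/andP[/andP[sS _] _] /eqP SE].
have fS : f \notin S by rewrite -SE setD11.
rewrite big_setU1 //= Dmin //; congr (_ * _).
by apply: eq_bigr => i _; rewrite setUCA setUA.
Qed.

Lemma monomial_basis0 W : monomial_basis set0 W [:: 0%MM].
Proof.
split=> // [m|d p /dhomogP hp|p sp Jp].
- by rewrite inE => /eqP-> i _; rewrite mnm0E.
- rewrite [p]mpolyE big_seq; apply: spanned_sum => m mp; apply: spannedZ.
  have [m0|m0] := eqVneq m 0%MM.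
    exists 'X_[m]; rewrite subrr msuppX m0; split=> //; last exact: TowerZero.
    by rewrite dhomogX -(hp _ mp) m0.
  have [i mi] : exists i, m i != 0%N.
    apply/existsP; apply: contraNT m0 => /existsPn m0; apply/eqP/mnmP => i.
    by rewrite mnm0E; apply/eqP; rewrite -[_ == _]negbK.
  apply: spanned_ideal; rewrite -(@submK _ U_(i)%MM m) ?lep1mP // mpolyXD.
  by apply: TowerMul; apply: TowerVar; rewrite inE.
have p0 : p@_0%MM = 0.
  elim: Jp => [|q r _ q0 _ r0|a q _ q0|i _|S h]; last by rewrite inE.
  - exact: mcoeff0.
  - by rewrite mcoeffD q0 r0 addr0.
  - by rewrite [LHS](rmorphM (mcoeff 0%MM)) /= q0 mulr0.
  - by rewrite mcoeffX mnm1_eq0.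
apply/mpolyP => m; rewrite mcoeff0; have [->//|m0] := eqVneq m 0%MM.
by apply/eqP; rewrite mcoeff_eq0; apply/negP => /sp; rewrite inE (negPf m0).
Qed.

(** The generator attached to the empty set and [f] is then 1, so the quotient is zero. *)
Lemma monomial_basis_null U W f : f \in U -> D W f = 0%N -> monomial_basis U W [::].
Proof.
move=> fU D0; split=> // [d p _|p sp _].
  apply: spanned_ideal; rewrite -[p]mulr1; apply: TowerMul.
  have -> : 1 = xprod set0 * ysum f ^+ 0 by rewrite /xprod big_set0 mul1r.
  by apply: tower_ideal_gen => //; rewrite set0U D0.
by apply/mpolyP => m; rewrite mcoeff0; apply/eqP; rewrite mcoeff_eq0; apply/negP => /sp.
Qed.

Lemma exists_minimal U : U != set0 -> exists2 f, f \in U & forall i, i \in U -> ~~ lt i f.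
Proof.
case/set0Pn => f0 f0U.
case: (arg_minnP (fun f => #|[set i | le i f]|) f0U) => f fU minf.
exists f => // i iU; apply/negP => /andP[nif lif].
have := minf i iU; rewrite leqNgt => /negP; apply; apply: proper_card.
apply/properP; split; first by apply/subsetP => j; rewrite !inE => /le_trans; apply.
exists f; rewrite !inE ?le_refl //; apply: contra nif => lfi.
by apply/eqP/le_anti; rewrite lif.
Qed.

(** Induction on the size of [U], for all [W] at once: deleting a minimal [f] calls for the bases of
    the remaining tower with prescribed sets [W] and [f |: W]. *)
Theorem tower_basis U W : (forall i j, i \in U -> le i j -> j \in U) ->
  exists2 s, monomial_basis U W s & \sum_(m <- s) 'X^(mdeg m) = tower_hilbert U W.
Proof.
have [N leN] := ubnP #|U|; elim: N => // N IHN in U W leN * => U_up.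
have [->|U0] := eqVneq U set0.
  exists [:: 0%MM]; first exact: monomial_basis0.
  by rewrite big_seq1 mdeg0 expr0 tower_hilbert0.
have [f fU fmin] := exists_minimal U0; pose V := U :\ f.
have UE : U = f |: V by rewrite setD1K.
have fV : f \notin V by rewrite setD11.
have [c0|c_gt0] := posnP (D W f).
  exists [::]; first exact: monomial_basis_null c0.
  by rewrite big_nil (tower_hilbert_null fU).
have V_up i j : i \in V -> le i j -> j \in V.
  rewrite !inE => /andP[nif iU] lij; rewrite (U_up _ _ iU lij) andbT.
  by apply: contra (fmin i iU) => /eqP jf; rewrite /lt nif -jf.
have f_up i : lt f i -> i \in V.
  by case/andP=> nfi lfi; rewrite !inE eq_sym nfi (U_up _ _ fU lfi).
have ltV : (#|V| < N)%N by move: leN; rewrite (cardsD1 f U) fU.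
have [sI BI hI] := IHN V W ltV V_up.
have [sK BK hK] := IHN V (f |: W) ltV V_up.
exists (blowup_basis f W sI sK); first by rewrite UE; apply: blowup_basisP.
rewrite UE tower_hilbertU1 // big_cat /= hI; congr (_ + _).
rewrite big_allpairs_dep /= -hK /truncated_geometric mulr_suml.
rewrite /index_iota subn1; apply: eq_bigr => l _; rewrite mulr_sumr.
by apply: eq_bigr => m _; rewrite mdegD mdegMn mdeg1 mul1n exprD mulrC.
Qed.

End Tower.

(** * Flats and building sets *)

Section FlatTheory.
Variables (E : finType) (M : polymatroid E).
Implicit Types (A B F H X : {set E}) (S T : {set {set E}}).
Local Notation rk := (rk M).
Local Notation flat := (flat M).
Local Notation cl := (cl M).
Local Notation join := (join M).

Lemma flatT : flat setT.
Proof. by apply/forallP => e; rewrite in_setT. Qed.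

(** An element outside the intersection is outside one of the flats, and submodularity carries the
    rank increase from that flat down to the intersection. *)
Lemma flatI F H : flat F -> flat H -> flat (F :&: H).
Proof.
have aux F' H' e : flat F' -> e \notin F' -> (rk (F' :&: H') < rk (e |: (F' :&: H')))%N.
  move=> fF eF; have /implyP/(_ eF) ltF := forallP fF e.
  have := rk_submod M F' (e |: (F' :&: H')).
  have -> : F' :|: (e |: (F' :&: H')) = e |: F' by rewrite setUCA [F' :&: _]setIC setKI.
  have -> : F' :&: (e |: (F' :&: H')) = F' :&: H'.
    apply/setP => x; rewrite !inE; case: eqP => [->|_] /=; first by rewrite (negPf eF).
    by rewrite andbA andbb.
  by lia.
move=> fF fH; apply/forallP => e; apply/implyP; rewrite inE negb_and.
by case/orP => [/(aux F H e fF)|/(aux H F e fH)] //; rewrite setIC.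
Qed.

Lemma cl_flat A : flat (cl A).
Proof.
by rewrite /Defs.cl; elim/big_ind: _ => [|F H|F /andP[]//]; [exact: flatT | exact: flatI].
Qed.

Lemma sub_cl A : A \subset cl A.
Proof. by apply/bigcapsP => F /andP[]. Qed.

Lemma cl_min A F : flat F -> A \subset F -> cl A \subset F.
Proof. by move=> fF sAF; apply: bigcap_inf; rewrite fF. Qed.

Lemma cl_id F : flat F -> cl F = F.
Proof. by move=> fF; apply/eqP; rewrite eqEsubset sub_cl cl_min. Qed.

Lemma clS A B : A \subset B -> cl A \subset cl B.
Proof. by move=> sAB; apply: cl_min (cl_flat B) (subset_trans sAB (sub_cl B)). Qed.

(** A maximal superset of [A] of the same rank is a flat, so it contains the closure. *)
Lemma rk_cl A : rk (cl A) = rk A.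
Proof.
have [B maxB sAB] : {B | maxset (fun B => (A \subset B) && (rk B == rk A)) B & A \subset B}.
  by apply: maxset_exists; rewrite subxx eqxx.
have /andP[_ /eqP rB] := maxsetp maxB.
suff fB : flat B by apply/eqP; rewrite eqn_leq -{1}rB !rk_mono ?sub_cl ?cl_min.
apply/forallP => e; apply/implyP => eB; rewrite ltn_neqAle rk_mono ?subsetUr // andbT.
apply: contra eB => /eqP rE; rewrite -(@maxsetsup _ _ _ (e |: B) maxB).
- by rewrite setU11.
- by rewrite (subset_trans sAB) ?subsetUr //= -rE rB.
- exact: subsetUr.
Qed.

Lemma flat_eq F A : flat F -> F \subset A -> (rk A <= rk F)%N -> F = A.
Proof.
move=> fF sFA rA; apply/eqP; rewrite eqEsubset sFA; apply/subsetP => e eA.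
apply: contraLR rA => eF; rewrite -ltnNge.
have /implyP/(_ eF) := forallP fF e; move/leq_trans; apply.
by rewrite rk_mono // subUset sub1set eA.
Qed.

Lemma join_flat S : flat (join S). Proof. exact: cl_flat. Qed.

Lemma join_ub S X : X \in S -> X \subset join S.
Proof. by move=> XS; apply: subset_trans (sub_cl _); apply: bigcup_sup. Qed.

Lemma join_lub S F : flat F -> (forall X, X \in S -> X \subset F) -> join S \subset F.
Proof. by move=> fF sF; apply: cl_min => //; apply/bigcupsP. Qed.

Lemma joinS S T : S \subset T -> join S \subset join T.
Proof.
by move=> sST; apply: join_lub (join_flat T) _ => X /(subsetP sST); apply: join_ub.
Qed.

Lemma join1 F : flat F -> join [set F] = F.
Proof. by move=> fF; rewrite /Defs.join big_set1 cl_id. Qed.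

Lemma join_eq S F : flat F -> (forall X, X \in S -> X \subset F) ->
  F \subset join S -> join S = F.
Proof. by move=> fF sS sF; apply/eqP; rewrite eqEsubset sF join_lub. Qed.

Lemma sup_below_flat S F : flat (sup_below M S F). Proof. exact: join_flat. Qed.

Lemma sup_below_sub S F : flat F -> sup_below M S F \subset F.
Proof. by move=> fF; apply: join_lub => // X; rewrite inE => /andP[_ /proper_sub]. Qed.

Lemma sup_belowS S T F : S \subset T -> sup_below M S F \subset sup_below M T F.
Proof.
by move=> sST; apply: joinS; apply/subsetP => X; rewrite !inE => /andP[/(subsetP sST) ->].
Qed.

Lemma sup_below_ub S F X : X \in S -> X \proper F -> X \subset sup_below M S F.
Proof. by move=> XS XF; apply: join_ub; rewrite inE XS. Qed.

Hypothesis M_loopless : loopless M.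

Lemma join0 : join set0 = set0.
Proof. by rewrite /Defs.join big_set0 cl_id. Qed.

Variable G : {set {set E}}.
Hypothesis G_building : building_set M G.

Lemma building_flat X : X \in G -> flat X.
Proof. by case: G_building => H _ /H[]. Qed.

Lemma building_neq0 X : X \in G -> X != set0.
Proof. by case: G_building => H _ /H[]. Qed.

Lemma factorsP F X : X \in factors G F ->
  [/\ X \in G, X \subset F & forall Y, Y \in G -> Y \subset F -> X \subset Y -> X = Y].
Proof.
rewrite inE => maxX; have := maxsetp maxX; rewrite inE => /andP[XG XF].
split=> // Y YG YF sXY; apply/esym; apply: (maxsetsup maxX) => //.
by rewrite inE YG.
Qed.

Lemma factors_exists F X : X \in G -> X \subset F ->
  exists2 C, C \in factors G F & X \subset C.
Proof.
move=> XG XF.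
have [C maxC sXC] : {C | maxset (fun Y => Y \in [set X in G | X \subset F]) C & X \subset C}.
  by apply: maxset_exists; rewrite inE XG.
by exists C => //; rewrite inE.
Qed.

(** By surjectivity of the product map, [F] is the join of a tuple whose components lie below the
    factors. *)
Lemma join_factors F : flat F -> join (factors G F) = F.
Proof.
move=> fF; have [_ /(_ F fF)[[surj _ _ _] _]] := G_building.
apply: join_eq => // [X /factorsP[]//|].
have : F \in lower_interval M F by rewrite inE fF subxx.
rewrite -surj => /imsetP[phi /pfamilyP[_ phiF] FE]; rewrite {1}FE.
apply: join_lub (join_flat _) _ => _ /imsetP[X XF ->].
have := phiF X XF; rewrite inE => /andP[_ /subset_trans]; apply.
exact: join_ub.
Qed.

Definition factor_complement F C := join (factors G F :\ C).

(** The tuple supported at [C] and the one supported at the other factors have componentwise meet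
    [set0], and the product map preserves meets. *)
Lemma cofactor_disjoint F C : flat F -> C \in factors G F -> C :&: factor_complement F C = set0.
Proof.
move=> fF CF; have [_ /(_ F fF)[[_ _ _ meet] _]] := G_building.
have [CG _ _] := factorsP CF.
pose phi := [ffun X => if X == C then C else set0] : {ffun {set E} -> {set E}}.
pose psi := [ffun X => if X \in factors G F :\ C then X else set0] : {ffun {set E} -> {set E}}.
have tuple (b : pred {set E}) : b \subset factors G F ->
    [ffun X => if b X then X else set0] \in factor_tuples M G F.
  move=> sb; apply/pfamilyP; split.
    apply/subsetP => X; rewrite inE ffunE; case: ifP; last by rewrite eqxx.
    by move=> bX _; apply: (subsetP sb).
  move=> X XF; rewrite inE ffunE; case: ifP => _; last by rewrite sub0set andbT.
  by rewrite subxx andbT building_flat //; case/factorsP: XF.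
have phiT : phi \in factor_tuples M G F.
  have -> : phi = [ffun X => if pred1 C X then X else set0].
    by apply/ffunP => X; rewrite !ffunE /=; case: eqP => // ->.
  by apply: tuple; apply/subsetP => X /eqP->.
have psiT : psi \in factor_tuples M G F.
  by apply: tuple; apply/subsetP => X; rewrite [X \in _]inE => /andP[].
have phiE : factor_join M G F phi = C.
  apply: join_eq; first exact: building_flat.
    by move=> _ /imsetP[X _ ->]; rewrite ffunE; case: ifP => _; rewrite ?sub0set.
  by apply: join_ub; apply/imsetP; exists C => //; rewrite ffunE eqxx.
have psiE : factor_join M G F psi = factor_complement F C.
  apply: join_eq; first exact: join_flat.
    move=> _ /imsetP[X _ ->]; rewrite ffunE; case: ifP => [XF|_]; last by rewrite sub0set.
    exact: join_ub.
  apply: join_lub (join_flat _) _ => X XF; apply: join_ub; apply/imsetP; exists X.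
    by case/setD1P: XF.
  by rewrite ffunE XF.
have := meet _ _ phiT psiT; rewrite phiE psiE => <-.
apply: join_eq => //; last by rewrite sub0set.
move=> _ /imsetP[X _ ->]; rewrite !ffunE; case: eqP => [->|_]; last by rewrite set0I.
by rewrite !inE eqxx /= setI0.
Qed.

Lemma factors_disjoint F C1 C2 : flat F -> C1 \in factors G F -> C2 \in factors G F ->
  C1 != C2 -> C1 :&: C2 = set0.
Proof.
move=> fF F1 F2 n12; apply/eqP; rewrite -subset0 -(cofactor_disjoint fF F1).
by apply: setIS; apply: join_ub; apply/setD1P; rewrite eq_sym.
Qed.

(** The factors of the join that contain [X] and [Y] intersect, so they coincide; this common factor
    contains both and must be the whole join. *)
Lemma building_join X Y : X \in G -> Y \in G -> X :&: Y != set0 -> cl (X :|: Y) \in G.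
Proof.
move=> XG YG nXY; set L := cl _; have fL : flat L by apply: cl_flat.
have sXL : X \subset L by apply: subset_trans (sub_cl _); apply: subsetUl.
have sYL : Y \subset L by apply: subset_trans (sub_cl _); apply: subsetUr.
have [C CF sXC] := factors_exists XG sXL; have [C' CF' sYC] := factors_exists YG sYL.
have CC' : C = C'.
  apply/eqP; apply: contraNT nXY => /(factors_disjoint fL CF CF') CC0.
  by rewrite -subset0 -CC0 setISS.
have [CG sCL _] := factorsP CF; rewrite (_ : L = C) //.
apply/eqP; rewrite eqEsubset sCL andbT; apply: cl_min; first exact: building_flat.
by rewrite subUset sXC CC'.
Qed.

End FlatTheory.

(** * Nested sets and the monomial basis of the Chow ring *)

Section Nested.
Variables (E : finType) (M : polymatroid E) (G : {set {set E}}).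
Hypothesis M_loopless : loopless M.
Hypothesis G_building : building_set M G.
Implicit Types (F X Y C : {set E}) (S T A : {set {set E}}).

Lemma maximal_elements_sub T : maximal_elements T \subset T.
Proof. by apply/subsetP => X; rewrite inE => /maxsetp. Qed.

Lemma join_maximal_elements T : (forall X, X \in T -> flat M X) ->
  join M (maximal_elements T) = join M T.
Proof.
move=> fT; apply: join_eq; first exact: join_flat.
  by move=> X /(subsetP (maximal_elements_sub T)); apply: join_ub.
apply: join_lub (join_flat _ _) _ => X XT.
have [C maxC sXC] : {C | maxset (fun Y => Y \in T) C & X \subset C}.
  exact: maxset_exists.
by apply: (subset_trans sXC); apply: join_ub; rewrite inE.
Qed.

Lemma maximal_elements_antichain T : antichain (maximal_elements T).
Proof.
apply/forall_inP => X; rewrite inE => mX; apply/forall_inP => Y; rewrite inE => mY.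
apply/implyP => nXY; apply/andP; split; apply: contra nXY => sXY.
  by rewrite (maxsetsup mX (maxsetp mY) sXY).
by rewrite (maxsetsup mY (maxsetp mX) sXY).
Qed.

Lemma nested_sub S : nested M G S -> S \subset G.
Proof. by case/andP. Qed.

Lemma nestedS S T : T \subset S -> nested M G S -> nested M G T.
Proof.
move=> sTS /andP[sSG /forallP nS]; rewrite /nested (subset_trans sTS sSG) /=.
apply/forallP => A; apply/implyP => /and3P[sAT A2 aA].
by apply: (implyP (nS A)); rewrite (subset_trans sAT sTS) A2.
Qed.

(** The maximal elements of [T] form an antichain with the same join. Nestedness excludes two or
    more of them; a single one would be [C] itself, and none would make [C] empty. *)
Lemma nested_join_neq S T C : nested M G S -> T \subset S -> C \in G -> C \notin T ->
  join M T != C.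
Proof.
move=> /andP[sSG /forallP nS] sTS CG CT; apply/eqP => JT.
have fT X : X \in T -> flat M X.
  by move=> XT; apply: (building_flat G_building); rewrite (subsetP sSG) ?(subsetP sTS).
set A := maximal_elements T; have JA : join M A = C by rewrite join_maximal_elements.
have sAT : A \subset T := maximal_elements_sub T.
have [A2|] := boolP (2 <= #|A|)%N.
  have := implyP (nS A); rewrite (subset_trans sAT sTS) A2 maximal_elements_antichain.
  by rewrite JA CG => /(_ isT).
rewrite -ltnNge ltnS leq_eqVlt => /orP[/cards1P[X AX]|].
  have XT : X \in T by rewrite (subsetP sAT) // AX set11.
  by rewrite -JA AX join1 ?fT // XT in CT.
rewrite ltnS leqn0 cards_eq0 => /eqP A0.
have := building_neq0 G_building CG.
by rewrite -JA A0 join0 ?eqxx.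
Qed.

(** This form of nestedness matches the nonvanishing of exponents in [tower_hilbert]. An antichain
    of at least two elements lies strictly below its join, so a join [F] in [G] would force
    [sup_below M S F = F]. *)
Lemma nestedE S : S \subset G ->
  nested M G S = [forall F in G, sup_below M S F != F].
Proof.
move=> sSG; apply/idP/forall_inP => [nS F FG|nS].
  apply: (nested_join_neq nS) => //; last by rewrite inE properxx andbF.
  by apply/subsetP => X; rewrite inE => /andP[].
rewrite /nested sSG; apply/forallP => A; apply/implyP => /and3P[sAS A2 aA].
apply/negP => JG; case/negP: (nS _ JG).
rewrite eqEsubset sup_below_sub ?join_flat //=; apply: joinS.
apply/subsetP => X XA; rewrite inE (subsetP sAS) // properEneq join_ub // andbT.
apply/eqP => XJ.
have : (0 < #|A :\ X|)%N by rewrite (cardsD1 X A) XA in A2.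
rewrite card_gt0 => /set0Pn[Y /setD1P[nYX YA]].
have := implyP (forall_inP (forall_inP aA Y YA) X XA) nYX; rewrite /incomparable.
by rewrite {1}XJ join_ub.
Qed.

End Nested.

(** * The Chow ring as the top of a tower *)

Section ChowTower.
Variables (E : finType) (M : polymatroid E) (G : {set {set E}}).
Hypothesis M_loopless : loopless M.
Hypothesis G_building : building_set M G.
Local Notation n := #|G|.
Local Notation rk := (rk M).
Local Notation A := {mpoly rat[n]}.
Implicit Types (i j k f h : 'I_n) (S T U W : {set 'I_n}).

Local Notation ev := (@enum_val _ (mem G)).

Definition index_le i j : bool := ev i \subset ev j.
Definition index_rank S j : nat := (rk (ev j) - rk (sup_below M (ev @: S) (ev j)))%N.

Local Notation le := index_le.
Local Notation D := index_rank.
Local Notation lt i j := ((i != j) && le i j).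

Lemma index_ltE i j : ((i != j) && le i j) = (ev i \proper ev j).
Proof. by rewrite properEneq (inj_eq enum_val_inj). Qed.

Lemma ev_flat i : flat M (ev i).
Proof. exact: (building_flat G_building) (enum_valP i). Qed.

Lemma mem_ev i S : (ev i \in ev @: S) = (i \in S).
Proof. by rewrite mem_imset //; apply: enum_val_inj. Qed.

Lemma ev_surj X : X \in G -> exists i, ev i = X.
Proof. by move=> XG; exists (enum_rank_in XG X); rewrite enum_rankK_in. Qed.

Lemma index_le_anti : antisymmetric le.
Proof.
by move=> i j; rewrite /index_le -eqEsubset => /eqP/enum_val_inj.
Qed.

Lemma index_le_trans : transitive le.
Proof. by move=> j i k; apply: subset_trans. Qed.

Lemma index_rank_anti S T j : S \subset T -> (D T j <= D S j)%N.
Proof. by move=> sST; rewrite leq_sub2l ?rk_mono ?sup_belowS ?imsetS. Qed.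

Lemma index_rank_local S T j :
  (forall i, lt i j -> (i \in S) = (i \in T)) -> D S j = D T j.
Proof.
move=> eST; rewrite /index_rank /sup_below; congr (_ - rk (join M _))%N.
apply/setP => X; rewrite !inE; case Xj: (X \proper ev j); rewrite ?andbF ?andbT //.
by apply/imsetP/imsetP => -[i iS XE]; exists i => //;
  [rewrite -eST // | rewrite eST //]; rewrite index_ltE -XE.
Qed.

Lemma sup_below_imsetU1 f S h : ev f \proper ev h ->
  sup_below M (ev @: (f |: S)) (ev h) = cl M (ev f :|: sup_below M (ev @: S) (ev h)).
Proof.
move=> fh; apply: join_eq; first exact: cl_flat.
  move=> X; rewrite imsetU1 !inE => /andP[/orP[/eqP->|XS] Xh];
    apply: subset_trans (sub_cl _ _); first exact: subsetUl.
  by apply: subset_trans (subsetUr _ _); apply: sup_below_ub.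
apply: cl_min; first exact: join_flat.
rewrite subUset sup_below_ub ?mem_ev ?setU11 //=; apply: sup_belowS.
by apply: imsetS; apply: subsetUr.
Qed.

(** Submodularity for [ev f] and the supremum of [S] below [ev h]: their intersection contains the
    supremum of [W] below [ev f], and their union lies in [ev h]. *)
Lemma index_rank_add W S f h : W \subset S -> lt f h ->
  (D S h <= D (f |: S) h + D W f)%N.
Proof.
rewrite index_ltE => sWS fh; rewrite /index_rank sup_below_imsetU1 // rk_cl.
set L := sup_below M (ev @: S) _; set L' := sup_below _ _ _.
have sub : L' \subset ev f :&: L.
  rewrite subsetI sup_below_sub ?ev_flat //=; apply: join_lub (sup_below_flat _ _ _) _.
  move=> X; rewrite inE => /andP[XW Xf]; apply: sup_below_ub.
    by apply: subsetP XW; apply: imsetS.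
  exact: proper_trans Xf fh.
have sm := rk_submod M (ev f) L; have r1 := rk_mono M sub.
have r2 : (rk (ev f :|: L) <= rk (ev h))%N.
  by rewrite rk_mono // subUset proper_sub //= sup_below_sub ?ev_flat.
have r3 : (rk L' <= rk (ev f))%N by rewrite rk_mono ?sup_below_sub ?ev_flat.
by lia.
Qed.

Lemma index_rank_lt S f k h : lt f k -> lt k h -> (D (k |: S) h <= D (f |: S) h)%N.
Proof.
rewrite !index_ltE => fk kh; have fh := proper_trans fk kh.
rewrite /index_rank leq_sub2l // !sup_below_imsetU1 // rk_mono //.
by apply: clS; apply: setSU; apply: proper_sub.
Qed.

(** The flats of [h] and [k] both contain the nonempty flat of [f], so [building_join] puts their
    join in [G]. *)
Lemma index_rank_join f h k : lt f h -> lt f k -> ~~ le h k -> ~~ le k h ->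
  exists j, [/\ le h j, le k j,
     (forall i, le h i -> le k i -> le j i),
     (forall S, (D (k |: S) j <= D (f |: S) h)%N) & D [set h; k] j = 0%N].
Proof.
rewrite !index_ltE /index_le => fh fk nhk nkh.
have JG : cl M (ev h :|: ev k) \in G.
  apply: building_join => //; try exact: enum_valP.
  have := building_neq0 G_building (enum_valP f).
  by apply: contraNneq => e0; rewrite -subset0 -e0 subsetI !proper_sub.
have [j jE] := ev_surj JG; exists j.
have sub : ev h :|: ev k \subset ev j by rewrite jE sub_cl.
have [sh sk] : ev h \subset ev j /\ ev k \subset ev j by apply/andP; rewrite -subUset.
have ph : ev h \proper ev j by rewrite properE sh; apply: contra nkh; apply: subset_trans.
have pk : ev k \proper ev j by rewrite properE sk; apply: contra nhk; apply: subset_trans.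
have rj : rk (ev j) = rk (ev h :|: ev k) by rewrite jE rk_cl.
split=> // [i hi ki|S|].
- by rewrite jE cl_min ?ev_flat // subUset hi.
- rewrite /index_rank.
  set P := sup_below M _ (ev h); set Q := sup_below M _ (ev j).
  have sPh : P \subset ev h by rewrite sup_below_sub ?ev_flat.
  have sQ : P :|: ev k \subset Q.
    have kQ : ev k \subset Q by rewrite sup_below_ub ?mem_ev ?setU11.
    rewrite subUset kQ andbT; apply: join_lub (sup_below_flat _ _ _) _ => X.
    rewrite inE imsetU1 !inE => /andP[/orP[/eqP->|XS] Xh].
      exact: subset_trans (proper_sub fk) kQ.
    by apply: sup_below_ub; [rewrite imsetU1 inE XS orbT | apply: proper_trans Xh ph].
  (* The union has the rank of [ev j] and the intersection contains [P]; with [P :|: ev k] inside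
     [Q], this gives rk (ev j) + rk P <= rk (ev h) + rk Q. *)
  have := rk_submod M (ev h) (P :|: ev k).
  rewrite setUA (setUidPl sPh) -rj => sm.
  have r1 : (rk P <= rk (ev h :&: (P :|: ev k)))%N.
    by rewrite rk_mono // subsetI sPh subsetUl.
  have r2 := rk_mono M sQ; have r3 := rk_mono M sPh.
  move: sm r1 r2 r3; move: (rk _) (rk _) (rk _) (rk _) (rk _) (rk _).
  by clear; lia.
- apply/eqP; rewrite subn_eq0 rj rk_mono // subUset.
  by rewrite !sup_below_ub ?mem_ev // !inE eqxx ?orbT.
Qed.

Lemma chow_generatorE S j :
  chow_generator M G (ev @: S) (ev j) = xprod rat S * ysum rat le j ^+ D S j.
Proof.
by rewrite /chow_generator; congr (_ * _); apply: eq_bigl => i; rewrite mem_ev.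
Qed.

Lemma imset_ev (S : {set {set E}}) : S \subset G -> ev @: [set i | ev i \in S] = S.
Proof.
move=> sSG; apply/setP => X; apply/imsetP/idP => [[i + ->]|XS]; first by rewrite inE.
by have [i iX] := ev_surj (subsetP sSG X XS); exists i; rewrite // inE iX.
Qed.

Lemma chow_idealM (a p : A) : chow_ideal M p -> chow_ideal M (a * p).
Proof.
move=> [c ->]; exists (fun X F => a * c X F); rewrite mulr_sumr; apply: eq_bigr => S _.
by rewrite mulr_sumr; apply: eq_bigr => F _; rewrite mulrA.
Qed.

Lemma chow_ideal_generator (S : {set {set E}}) (F : {set E}) :
  S \subset G -> F \in G -> chow_ideal M (chow_generator M G S F).
Proof.
move=> sSG FG; exists (fun (S' : {set {set E}}) F' => ((S' == S) && (F' == F))%:R).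
rewrite (bigD1 S) //= (bigD1 F) //= !eqxx mul1r !big1 ?addr0 //.
  by move=> S' /andP[_ /negPf->]; rewrite big1 // => F' _; rewrite mul0r.
by move=> F' /andP[_ /negPf->]; rewrite mul0r.
Qed.

(** With [U] everything no variable is killed, and with [W] empty the tower generators are exactly
    the Chow generators. *)
Lemma chow_idealE (p : A) : chow_ideal M p <-> tower_ideal le D setT set0 p.
Proof.
split=> [[c ->]|].
  apply: tower_ideal_sum => S sSG; apply: tower_ideal_sum => F FG.
  apply: TowerMul; have [j <-] := ev_surj FG; rewrite -(imset_ev sSG) chow_generatorE.
  by apply: tower_ideal_gen; rewrite ?inE ?setU0.
elim=> {p} [|p q _ Ip _ Iq|a p _ Ip|i|S h _]; last 1 first.
- rewrite setU0 -chow_generatorE; apply: chow_ideal_generator; last exact: enum_valP.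
  by apply/subsetP => _ /imsetP[i _ ->]; apply: enum_valP.
- exact: chow_ideal0.
- exact: chow_idealD.
- exact: chow_idealM.
- by rewrite inE.
Qed.

Definition nested_hilbert : {poly int} :=
  \sum_(S : {set {set E}} | nested M G S)
    \prod_(F in S) truncated_geometric (rk F - rk (sup_below M S F)).

Lemma index_rank_eq0 S j : (D S j == 0%N) = (sup_below M (ev @: S) (ev j) == ev j).
Proof.
rewrite /index_rank subn_eq0; apply/idP/eqP => [le|->//].
by apply: flat_eq le; rewrite ?sup_below_flat ?sup_below_sub ?ev_flat.
Qed.

Lemma tower_hilbert_nested : tower_hilbert D setT set0 = nested_hilbert.
Proof.
rewrite /nested_hilbert (reindex_onto (fun S => ev @: S) (fun S' : {set {set E}} => [set i | ev i \in S'])) /=.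
  apply: eq_big => [S|S _].
    have SK : [set i | ev i \in ev @: S] = S by apply/setP => i; rewrite inE mem_ev.
    rewrite SK eqxx andbT subsetT setU0 nestedE //=; last first.
      by apply/subsetP => _ /imsetP[i _ ->]; apply: enum_valP.
    apply/forall_inP/forall_inP => H => [F FG|j _]; last first.
      by rewrite index_rank_eq0 H ?enum_valP.
    by have [j <-] := ev_surj FG; rewrite -index_rank_eq0 H ?inE.
  rewrite big_imset /=; last by move=> i j _ _; apply: enum_val_inj.
  by apply: eq_bigr => i _; rewrite setU0.
by move=> S /nested_sub; apply: imset_ev.
Qed.

Theorem chow_hilbert_nested : exists2 H : nat -> nat, hilbert_series M G H &
  forall d : nat, (H d)%:Z = nested_hilbert`_d.
Proof.
have up i j : i \in [set: 'I_n] -> le i j -> j \in [set: 'I_n].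
  by rewrite !inE.
have [s [us _ span free] hs] := tower_basis rat (fun i => subxx (ev i)) index_le_anti
  index_le_trans index_rank_anti index_rank_local index_rank_add index_rank_lt
  index_rank_join set0 up.
exists (fun d => size [seq m <- s | mdeg m == d]) => d; last first.
  rewrite -tower_hilbert_nested -hs coef_sum size_filter -sum1_count.
  rewrite (big_morph Posz PoszD (erefl _)) big_mkcond /=; apply: eq_bigr => m _.
  by rewrite coefXn eq_sym; case: eqP.
set t := filter _ s; have ut : uniq t by apply: filter_uniq.
have tP m : m \in t = (mdeg m == d) && (m \in s) by rewrite mem_filter.
have sumE (c : 'X_{1..n} -> rat) :
    \sum_(j < size t) c (nth 0%MM t j) *: 'X_[nth 0%MM t j] = \sum_(m <- t) c m *: 'X_[m] :> A.
  by rewrite (big_nth 0%MM) big_mkord.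
have coefE (c : 'X_{1..n} -> rat) m :
    (\sum_(m' <- t) c m' *: 'X_[m'] : A)@_m = if m \in t then c m else 0.
  rewrite raddf_sum /=; under eq_bigr do rewrite mcoeffZ mcoeffX.
  case: ifP => mt.
    rewrite (bigD1_seq m) //= eqxx mulr1 big1 ?addr0 // => m' /negPf->.
    by rewrite mulr0.
  rewrite big_seq big1 // => m' m't; case: eqP => [e|_]; last by rewrite mulr0.
  by rewrite -e m't in mt.
exists (fun j : 'I_(size t) => 'X_[nth 0%MM t j]); split.
- by move=> j; rewrite dhomogX; have := mem_nth 0%MM (ltn_ord j); rewrite tP => /andP[].
- move=> p /span[r [/dhomogP hr sr Jr]]; exists (fun j : 'I_(size t) => r@_(nth 0%MM t j)).
  rewrite (sumE (fun m => r@_m)) /= (_ : \sum_(m <- t) _ = r); first exact/chow_idealE.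
  apply/mpolyP => m; rewrite coefE; case: ifP => // /negbT; rewrite tP => mt.
  apply/esym/eqP; rewrite mcoeff_eq0; apply: contra mt => mr.
  by rewrite sr // (hr m mr) /= eqxx.
move=> c /chow_idealE.
(* Coefficients indexed by positions in [t] become a function on monomials, with value 0 off [t]. *)
pose c' m := if insub (index m t) is Some j then c j else 0.
have c'E (j : 'I_(size t)) : c' (nth 0%MM t j) = c j.
  by rewrite /c' index_uniq // valK.
under eq_bigr do rewrite -c'E.
rewrite sumE => /free q0 j; rewrite -c'E.
have := coefE c' (nth 0%MM t j); rewrite mem_nth // q0 ?mcoeff0 => [<- //|m].
rewrite mcoeff_msupp coefE; case: ifP => [|_]; last by rewrite eqxx.
by rewrite tP => /andP[].
Qed.

End ChowTower.

(** * Characteristic polynomials of minors *)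

Section Mobius.
Variables (E : finType) (M : polymatroid E).
Implicit Types (F K L H : {set E}).

Lemma sum_mobius K H : flat M H -> K \subset H ->
  \sum_(L : {set E} | [&& flat M L, K \subset L & L \subset H]) mobius M K L = (K == H)%:R.
Proof.
move=> fH sKH; rewrite (bigD1 H) /=; last by rewrite fH sKH subxx.
rewrite mobiusE; have [<-|nKH] := eqVneq K H.
  rewrite big_pred0 ?addr0 // => L; rewrite -!andbA.
  by apply/negP => /and4P[_ s1 s2 /negP]; apply; rewrite eqEsubset s1 s2.
rewrite addrC; apply/eqP; rewrite subr_eq0; apply/eqP; apply: eq_bigl => L.
by rewrite properEneq -!andbA; congr [&& _, _ & _]; rewrite andbC.
Qed.

(* The Moebius function is a left inverse of the zeta matrix, hence a right *)
(* inverse.                                                                 *)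
Lemma sum_mobius_dual K H : flat M K -> flat M H -> K \subset H ->
  \sum_(L : {set E} | [&& flat M L, K \subset L & L \subset H]) mobius M L H = (K == H)%:R.
Proof.
move=> fK fH sKH; pose FL := [set F | flat M F].
pose ev (i : 'I_#|FL|) : {set E} := enum_val i.
have ev_inj : injective ev by apply: enum_val_inj.
pose A : 'M[int]_#|FL| := \matrix_(i, j) (if ev i \subset ev j then mobius M (ev i) (ev j) else 0).
pose Z : 'M[int]_#|FL| := \matrix_(i, j) (ev i \subset ev j)%:R.
have fP i : flat M (ev i) by have := enum_valP i; rewrite inE.
have sumFL (f : {set E} -> int) (P : pred {set E}) :
    \sum_(i < #|FL|) (if P (ev i) then f (ev i) else 0) =
    \sum_(L : {set E} | flat M L && P L) f L.
  rewrite -(@big_enum_val _ _ _ _ (mem FL) (fun L => if P L then f L else 0)) -big_mkcondr /=.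
  by apply: eq_bigl => L; rewrite inE.
have AZ : A *m Z = 1%:M.
  apply/matrixP => i j; rewrite !mxE -(inj_eq ev_inj).
  transitivity (\sum_(L : {set E} | [&& flat M L, ev i \subset L & L \subset ev j])
                  mobius M (ev i) L).
    rewrite -(sumFL _ (fun L => (ev i \subset L) && (L \subset ev j))).
    apply: eq_bigr => k _; rewrite !mxE.
    by case: (ev i \subset _) => /=; rewrite ?mul0r //;
       case: (_ \subset _); rewrite ?mulr1 ?mulr0.
  have [sij|nsij] := boolP (ev i \subset ev j); first exact: sum_mobius.
  rewrite big_pred0 => [|L]; last first.
    by apply/negP => /and3P[_ s1 s2]; rewrite (subset_trans s1 s2) in nsij.
  by case: eqP => // e; rewrite e subxx in nsij.
have ZA := mulmx1C AZ.
have KF : K \in FL by rewrite inE.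
have evK X : X \in FL -> ev (enum_rank_in KF X) = X by apply: enum_rankK_in.
have HF : H \in FL by rewrite inE.
have /matrixP/(_ (enum_rank_in KF K) (enum_rank_in KF H)) := ZA.
rewrite !mxE -(inj_eq ev_inj) !evK // => <-.
rewrite -(sumFL _ (fun L => (K \subset L) && (L \subset H))); apply: eq_bigr => k _.
rewrite !mxE !evK //.
by case: (K \subset _) => /=; rewrite ?mul0r //; case: (_ \subset _); rewrite ?mul1r ?mulr0.
Qed.

Lemma flat_rk_lt F (A : {set E}) e : flat M F -> A \subset F -> e \notin F -> (rk M A < rk M (e |: A))%N.
Proof.
move=> fF sAF eF; have /implyP/(_ eF) ltF := forallP fF e.
have := rk_submod M F (e |: A).
have -> : F :|: (e |: A) = e |: F by rewrite setUCA (setUidPl sAF).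
have -> : F :&: (e |: A) = A.
  by rewrite setIUr (setIidPr sAF) (_ : F :&: [set e] = set0) ?set0U //;
     apply/setP => x; rewrite !inE andbC; case: eqP => //= ->; apply/negbTE.
by lia.
Qed.

(** * The lattice of flats of a minor as an interval *)

Section Minor.
Variables F L : {set E}.
Hypothesis fF : flat M F.
Hypothesis fL : flat M L.
Hypothesis sLF : L \subset F.
Local Notation ground := {x : E | x \in F :\: L}.
Local Notation N := (minor M F L).
Implicit Types (A B : {set ground}).

Definition minor_lift A : {set E} := (val @: A) :|: L.
Definition minor_drop H : {set ground} := [set x | val x \in H].

Lemma mem_minor_lift A x : (val x \in minor_lift A) = (x \in A).
Proof.
rewrite inE mem_imset; last exact: val_inj.
by have := valP x; rewrite inE => /andP[/negPf-> _]; rewrite orbF.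
Qed.

Lemma minor_liftK : cancel minor_lift minor_drop.
Proof. by move=> A; apply/setP => x; rewrite inE mem_minor_lift. Qed.

Lemma minor_dropK H : L \subset H -> H \subset F -> minor_lift (minor_drop H) = H.
Proof.
move=> sLH sHF; apply/setP => x; rewrite inE.
have [xL|xL] := boolP (x \in L); first by rewrite orbT (subsetP sLH).
rewrite orbF; apply/imsetP/idP => [[y + ->]|xH]; first by rewrite inE.
have xP : x \in F :\: L by rewrite inE xL (subsetP sHF).
by exists (Sub x xP); rewrite ?inE !SubK.
Qed.

Lemma minor_lift_sub A : minor_lift A \subset F.
Proof.
rewrite subUset sLF andbT; apply/subsetP => _ /imsetP[x _ ->].
by have := valP x; rewrite inE => /andP[].
Qed.

Lemma sub_minor_lift A : L \subset minor_lift A.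
Proof. exact: subsetUr. Qed.

Lemma minor_liftS A B : (minor_lift A \subset minor_lift B) = (A \subset B).
Proof.
apply/idP/idP => [/subsetP s|s]; last by rewrite setSU ?imsetS.
by apply/subsetP => x; rewrite -!mem_minor_lift; apply: s.
Qed.

Lemma minor_lift_proper A B : (minor_lift A \proper minor_lift B) = (A \proper B).
Proof. by rewrite !properE !minor_liftS. Qed.

Lemma minor_lift0 : minor_lift set0 = L.
Proof. by rewrite /minor_lift imset0 set0U. Qed.

Lemma minor_liftT : minor_lift setT = F.
Proof.
rewrite -[RHS]minor_dropK //; congr minor_lift; apply/setP => x; rewrite !inE.
by have := valP x; rewrite inE => /andP[].
Qed.

Lemma minor_rkE A : rk N A = (rk M (minor_lift A) - rk M L)%N.
Proof. by []. Qed.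

(** Flatness in the minor tests only elements of [F :\: L]. Those of [L] already lie in the lift,
    and for those outside [F] the rank increase follows from flatness of [F]. *)
Lemma minor_flat A : flat N A = flat M (minor_lift A).
Proof.
have lU x : minor_lift (x |: A) = val x |: minor_lift A.
  by rewrite /minor_lift imsetU1 setUA.
have rL B : (rk M L <= rk M (minor_lift B))%N by rewrite rk_mono ?sub_minor_lift.
apply/forallP/forallP => [H e|H x].
  apply/implyP => eA; have [eF|] := boolP (e \in F); last first.
    by apply: flat_rk_lt => //; apply: minor_lift_sub.
  have eP : e \in F :\: L.
    by rewrite inE eF andbT; apply: contra eA; apply/subsetP/sub_minor_lift.
  have /implyP := H (Sub e eP); rewrite !minor_rkE lU -mem_minor_lift SubK => /(_ eA).
  by have := rL A; lia.
apply/implyP => xA; rewrite !minor_rkE lU.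
have /implyP := H (val x); rewrite mem_minor_lift => /(_ xA).
by have := rL A; lia.
Qed.

Lemma sum_minor_flats (V : nmodType) (P : pred {set E}) (f : {set E} -> V) :
  \sum_(A | flat N A && P (minor_lift A)) f (minor_lift A) =
  \sum_(H : {set E} | [&& flat M H, L \subset H, H \subset F & P H]) f H.
Proof.
rewrite [RHS](reindex_onto minor_lift minor_drop) /=; last first.
  by move=> H /and4P[_ sLH sHF _]; apply: minor_dropK.
apply: eq_bigl => A.
by rewrite minor_liftK eqxx andbT minor_flat sub_minor_lift minor_lift_sub.
Qed.

(** The Moebius recursion sees only the interval, and [minor_lift] identifies the flats of the minor
    with those between [L] and [F]. *)
Lemma minor_mobius A : mobius N set0 A = mobius M L (minor_lift A).
Proof.
have [k leA] := ubnP #|A|; elim: k => // k IHk in A leA *.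
have e0 : (L == minor_lift A) = (set0 == A).
  by rewrite -(can_eq minor_liftK) minor_lift0.
rewrite !mobiusE e0; case: ifP => // _; congr (- _).
transitivity (\sum_(B | flat N B && (minor_lift B \proper minor_lift A))
                mobius M L (minor_lift B)).
  apply: eq_big => [B|B /and3P[_ _ BA]]; first by rewrite sub0set minor_lift_proper.
  by rewrite IHk //; apply: leq_trans (proper_card BA) _; rewrite -ltnS.
rewrite (sum_minor_flats (fun H => H \proper minor_lift A)); apply: eq_bigl => H.
case HA: (H \proper _); last by rewrite !andbF.
by rewrite (subset_trans (proper_sub HA) (minor_lift_sub A)).
Qed.

Lemma minor_characteristic_poly : characteristic_poly N =
  \sum_(H : {set E} | [&& flat M H, L \subset H & H \subset F])
     mobius M L H *: 'X^(rk M F - rk M H).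
Proof.
rewrite /characteristic_poly.
transitivity (\sum_(A | flat N A && predT (minor_lift A))
                 mobius M L (minor_lift A) *: 'X^(rk M F - rk M (minor_lift A)) : {poly int}).
  apply: eq_big => [A|A _]; first by rewrite andbT.
  rewrite minor_mobius !minor_rkE minor_liftT; congr (_ *: 'X^_).
  have r1 : (rk M L <= rk M (minor_lift A))%N by rewrite rk_mono ?sub_minor_lift.
  by move: (rk M F) (rk M L) (rk M (minor_lift A)) r1; clear; lia.
rewrite (sum_minor_flats predT (fun H => mobius M L H *: 'X^(rk M F - rk M H))).
by apply: eq_bigl => H; rewrite andbT.
Qed.

End Minor.

Lemma minor_reduced_charP F L : flat M F -> flat M L -> L \proper F ->
  characteristic_poly (minor M F L) =
  reduced_characteristic_poly (minor M F L) * ('X - 1).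
Proof.
move=> fF fL /properP[sLF [x xF xL]]; apply: reduced_charP.
  apply/card_gt0P; have xP : x \in F :\: L by rewrite inE xL.
  by exists (Sub x xP).
by rewrite /loopless minor_flat // minor_lift0.
Qed.

(** Moebius inversion: after exchanging the sums, the coefficient attached to [H] is the sum of
    [mobius M L H] over [L] between [K] and [H], which vanishes unless [H = K]. *)
Lemma sum_minor_characteristic_poly F K : flat M F -> flat M K -> K \subset F ->
  \sum_(L : {set E} | [&& flat M L, K \subset L & L \subset F])
     characteristic_poly (minor M F L) = 'X^(rk M F - rk M K).
Proof.
move=> fF fK sKF.
under eq_bigr => L /and3P[fL sKL sLF] do rewrite minor_characteristic_poly //.
rewrite (exchange_big_dep (fun H => [&& flat M H, K \subset H & H \subset F])) /=; last first.
  by move=> L H /and3P[_ sKL _] /and3P[-> sLH ->]; rewrite (subset_trans sKL sLH).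
rewrite (bigD1 K) /=; last by rewrite fK subxx.
rewrite [X in _ + X]big1 ?addr0 => [|H /andP[/and3P[fH sKH sHF] nHK]].
  rewrite (big_pred1 K) ?mobiusE ?eqxx ?scale1r // => L /=.
  rewrite fK sKF andbT /=; apply/andP/eqP => [[/and3P[_ s1 _] s2]|->].
    by apply/eqP; rewrite eqEsubset s2.
  by rewrite fK subxx.
rewrite -scaler_suml (eq_bigl (fun L => [&& flat M L, K \subset L & L \subset H])).
  by rewrite sum_mobius_dual // eq_sym (negPf nHK) scale0r.
move=> L; rewrite fH sHF andbT; case sLH: (L \subset H); last by rewrite !andbF.
by rewrite (subset_trans sLH sHF) !andbT.
Qed.

(** The term [L = F] of the previous identity is 1; moving it to the other side leaves x^d - 1, and
    dividing by x - 1 gives the geometric sum. *)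
Lemma sum_reduced_characteristic_poly F K : flat M F -> flat M K -> K \subset F ->
  \sum_(L : {set E} | [&& flat M L, K \subset L & L \proper F])
     reduced_characteristic_poly (minor M F L) =
  \sum_(i < rk M F - rk M K) 'X^i.
Proof.
move=> fF fK sKF; apply: (mulIf (x := 'X - 1)).
  by rewrite -[1]/(1%:P) polyXsubC_eq0.
rewrite [RHS]mulrC -subrX1 -(sum_minor_characteristic_poly fF fK sKF).
have chiF : characteristic_poly (minor M F F) = 1.
  rewrite minor_characteristic_poly // (big_pred1 F) => [|H].
    by rewrite mobiusE eqxx subnn expr0 scale1r.
  rewrite /= -eqEsubset eq_sym andbC; case: eqP => // ->.
  by rewrite fF.
rewrite [in RHS](bigD1 F) ?fF ?sKF ?subxx //= chiF [1 + _]addrC addrK mulr_suml.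
apply: eq_big => [L|L /and3P[fL _ LF]]; last by rewrite -minor_reduced_charP.
by rewrite properEneq -!andbA; congr [&& _, _ & _]; rewrite andbC.
Qed.

End Mobius.

(** * Sums over nested sets *)

Section NestedSums.
Variables (E : finType) (M : polymatroid E) (G : {set {set E}}).
Hypothesis M_loopless : loopless M.
Hypothesis G_building : building_set M G.
Local Notation rk := (rk M).
Local Notation flat := (flat M).
Local Notation join := (join M).
Implicit Types (F X Y C L K : {set E}) (S T A : {set {set E}}).

Lemma joinU S T : join (S :|: T) = cl M (join S :|: join T).
Proof.
apply: join_eq; first exact: cl_flat.
  move=> X; rewrite inE => /orP[] XS; apply: subset_trans (sub_cl _ _).
    by apply: subset_trans (subsetUl _ _); apply: join_ub.
  by apply: subset_trans (subsetUr _ _); apply: join_ub.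
by apply: cl_min; rewrite ?join_flat // subUset !joinS ?subsetUl ?subsetUr.
Qed.

Lemma rk_join_le T : (rk (join T) <= \sum_(X in T) rk X)%N.
Proof.
rewrite /Defs.join rk_cl; elim/big_rec2: _ => [|X r A _ IH]; first by rewrite rk_set0.
have := rk_submod M X A; have := leq0n (rk (X :&: A)).
by move: (rk _) (rk _) (rk _) (rk _) IH; clear; lia.
Qed.

(** * Splitting off one factor of a flat *)

Section Factor.
Variables (L C : {set E}).
Hypothesis fL : flat L.
Hypothesis CL : C \in factors G L.
Local Notation L' := (factor_complement M G L C).

Let CG : C \in G. Proof. by case/factorsP: CL. Qed.
Let sCL : C \subset L. Proof. by case/factorsP: CL. Qed.
Let fC : flat C. Proof. exact: (building_flat G_building). Qed.
Let fL' : flat L'. Proof. exact: join_flat. Qed.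
Let CL'0 : C :&: L' = set0. Proof. exact: (cofactor_disjoint M_loopless G_building). Qed.

Lemma cofactor_sub : L' \subset L.
Proof. by apply: join_lub => // X /setD1P[_ /factorsP[]]. Qed.

Lemma cofactor_join : cl M (C :|: L') = L.
Proof.
by rewrite -[in RHS](join_factors G_building fL) -(setD1K CL) joinU join1.
Qed.

Lemma cofactor_rk : (rk C + rk L' <= rk L)%N.
Proof.
have [_ /(_ L fL)[_ ->]] := G_building.
by rewrite (big_setD1 C) //= leq_add2l rk_join_le.
Qed.

Lemma factor_or_cofactor X : X \in G -> X \subset L -> (X \subset C) || (X \subset L').
Proof.
move=> XG XL; have [C' C'L sXC'] := factors_exists XG XL.
have [<-|nC] := eqVneq C' C; first by rewrite sXC'.
by apply/orP; right; apply: subset_trans sXC' _; apply: join_ub; apply/setD1P.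
Qed.

Lemma factor_cofactor X : X \in G -> X \subset C -> X \subset L' -> False.
Proof.
move=> XG s1 s2; have := building_neq0 G_building XG.
by rewrite -subset0 -CL'0 subsetI s1 s2.
Qed.

Lemma subset_factor S X Y : S \subset G -> S \subset powerset Y -> X \in S ->
  (X \in G) /\ (X \subset Y).
Proof.
by move=> sG sY XS; rewrite (subsetP sG) //; have := subsetP sY X XS; rewrite powersetE.
Qed.

Section Split.
Variables S1 S2 : {set {set E}}.
Hypothesis S1G : S1 \subset G.
Hypothesis S2G : S2 \subset G.
Hypothesis S1C : S1 \subset powerset C.
Hypothesis S2L : S2 \subset powerset L'.

Let S1P X : X \in S1 -> (X \in G) /\ (X \subset C).
Proof. exact: subset_factor. Qed.
Let S2P X : X \in S2 -> (X \in G) /\ (X \subset L').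
Proof. exact: subset_factor. Qed.

(** If the join of an antichain is in [G], it lies below [C] or below [L']. These meet in [set0], so
    the whole antichain comes from [S1] or from [S2]. *)
Lemma split_nested : nested M G (S1 :|: S2) = nested M G S1 && nested M G S2.
Proof.
apply/idP/andP => [nS|[n1 n2]].
  by split; apply: nestedS nS; rewrite ?subsetUl ?subsetUr.
have sG : S1 :|: S2 \subset G by rewrite subUset S1G.
rewrite /nested sG; apply/forallP => A; apply/implyP => /and3P[sA A2 aA].
apply/negP => JG.
have JL : join A \subset L.
  apply: join_lub => // X /(subsetP sA); rewrite inE => /orP[/S1P[_ sX]|/S2P[_ sX]].
    exact: subset_trans sCL.
  exact: subset_trans cofactor_sub.
have contra1 S : A \subset S -> nested M G S -> False.
  move=> sAS /andP[_ /forallP/(_ A)/implyP]; rewrite sAS A2 aA JG.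
  by move/(_ isT).
case/orP: (factor_or_cofactor JG JL) => sJ.
  apply: (contra1 S1) => //; apply/subsetP => X XA; have := subsetP sA X XA.
  rewrite inE => /orP[//|/S2P[XG X2]]; exfalso; apply: (factor_cofactor XG) X2.
  exact: subset_trans (join_ub M XA) sJ.
apply: (contra1 S2) => //; apply/subsetP => X XA; have := subsetP sA X XA.
rewrite inE => /orP[/S1P[XG X1]|//]; exfalso; apply: (factor_cofactor XG X1).
exact: subset_trans (join_ub M XA) sJ.
Qed.

(** If the total join is [L], submodularity bounds rk [L] by the ranks of the two joins, while
    additivity of rank over factors gives rk [C] + rk [L'] <= rk [L]. Hence both joins have full
    rank. *)
Lemma split_join : (join (S1 :|: S2) == L) = (join S1 == C) && (join S2 == L').
Proof.
rewrite joinU; apply/eqP/andP => [JL|[/eqP-> /eqP->]]; last exact: cofactor_join.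
have s1 : join S1 \subset C by apply: join_lub => // X /S1P[].
have s2 : join S2 \subset L' by apply: join_lub => // X /S2P[].
have := rk_submod M (join S1) (join S2).
rewrite -(rk_cl M (_ :|: _)) JL; have := cofactor_rk.
have := rk_mono M s1; have := rk_mono M s2 => r2 r1 rL sm.
have : (rk C <= rk (join S1))%N /\ (rk L' <= rk (join S2))%N.
  move: r2 r1 rL sm.
  by move: (rk L) (rk C) (rk L') (rk (join S1)) (rk (join S2)) (rk (_ :&: _)); clear; lia.
by case=> /(flat_eq (join_flat M S1) s1)-> /(flat_eq (join_flat M S2) s2)->.
Qed.

Lemma split_disjoint : [disjoint S1 & S2].
Proof.
rewrite -setI_eq0; apply/eqP/setP => X; rewrite !inE; apply/negP => /andP[].
by move=> /S1P[XG X1] /S2P[_ X2]; apply: factor_cofactor X2.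
Qed.

Lemma split_sup1 F : F \in S1 -> sup_below M (S1 :|: S2) F = sup_below M S1 F.
Proof.
move=> F1; congr (join _); apply/setP => X; rewrite !inE.
case XF: (X \proper F); rewrite ?andbF ?andbT //; apply: orb_idr => /S2P[XG X2].
exfalso; apply: (factor_cofactor XG) X2.
by apply: subset_trans (proper_sub XF) _; case: (S1P F1).
Qed.

Lemma split_sup2 F : F \in S2 -> sup_below M (S1 :|: S2) F = sup_below M S2 F.
Proof.
move=> F2; congr (join _); apply/setP => X; rewrite !inE.
case XF: (X \proper F); rewrite ?andbF ?andbT //; apply: orb_idl => /S1P[XG X1].
exfalso; apply: (factor_cofactor XG X1).
by apply: subset_trans (proper_sub XF) _; case: (S2P F2).
Qed.

Lemma split_fst : (S1 :|: S2) :&: powerset C = S1.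
Proof.
rewrite setIUl (setIidPl S1C) (_ : S2 :&: _ = set0) ?setU0 //.
apply/setP => X; rewrite !inE; apply/negP => /andP[/S2P[XG X2] X1].
exact: (factor_cofactor XG X1).
Qed.

Lemma split_snd : (S1 :|: S2) :&: powerset L' = S2.
Proof.
rewrite setIUl (setIidPl S2L) (_ : S1 :&: _ = set0) ?set0U //.
apply/setP => X; rewrite !inE; apply/negP => /andP[/S1P[XG X1] X2].
exact: (factor_cofactor XG X1).
Qed.

End Split.

Lemma split_union S : S \subset G -> S \subset powerset L ->
  (S :&: powerset C) :|: (S :&: powerset L') = S.
Proof.
move=> sG sL; rewrite -setIUr; apply/setIidPl/subsetP => X XS; rewrite !inE.
have [XG XL] := subset_factor sG sL XS; exact: factor_or_cofactor.
Qed.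

End Factor.

(** * Recursions for weighted sums over nested sets *)

Section Weight.
Variable w : {set E} -> {set E} -> {poly int}.

Definition nested_weight S : {poly int} := \prod_(F in S) w F (sup_below M S F).

(** The flag [b] switches the condition on the join on and off, so that N and N' of the overview,
    and the part N0 with fixed join, share one set of lemmas. *)
Definition nested_below (b : bool) L S : bool :=
  [&& nested M G S, S \subset powerset L & b ==> (join S == L)].

Definition nested_sum (b : bool) L : {poly int} :=
  \sum_(S | nested_below b L S) nested_weight S.

(** A nested set below [L] is the disjoint union of its parts below [C] and below the complement;
    nestedness, joins and suprema are all computed separately on the parts. *)
Lemma nested_sum_factor b L C : flat L -> C \in factors G L ->
  nested_sum b L = nested_sum b C * nested_sum b (factor_complement M G L C).
Proof.
move=> fL CL; set L' := factor_complement M G L C.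
rewrite /nested_sum big_distrlr pair_big /=.
have [_ sCL _] := factorsP CL; have sL'L := cofactor_sub C fL.
rewrite (reindex_onto (fun p => p.1 :|: p.2)
   (fun S => (S :&: powerset C, S :&: powerset L'))) /=; last first.
  by move=> S /and3P[/nested_sub sG sL _]; apply: split_union.
apply: eq_big => [[S1 S2]|[S1 S2]] /=; last first.
  move=> /andP[/and3P[/nested_sub sG sL _] /eqP[e1 e2]].
  have [S1G S2G] : S1 \subset G /\ S2 \subset G by apply/andP; rewrite -subUset.
  have S1C : S1 \subset powerset C by rewrite -e1 subsetIr.
  have S2L : S2 \subset powerset L' by rewrite -e2 subsetIr.
  rewrite /nested_weight (eq_bigl (fun F => F \in [predU S1 & S2])); last first.
    by move=> F; rewrite !inE.
  rewrite bigU /=; last exact: (split_disjoint fL CL).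
  congr (_ * _); apply: eq_bigr => F FS.
    by rewrite (split_sup1 fL CL S1G S2G S1C S2L).
  by rewrite (split_sup2 fL CL S1G S2G S1C S2L).
apply/andP/andP => [[/and3P[nS sL jS] /eqP[e1 e2]]|[/and3P[n1 s1 j1] /and3P[n2 s2 j2]]].
  have sG := nested_sub nS.
  have [S1G S2G] : S1 \subset G /\ S2 \subset G by apply/andP; rewrite -subUset.
  have S1C : S1 \subset powerset C by rewrite -e1 subsetIr.
  have S2L : S2 \subset powerset L' by rewrite -e2 subsetIr.
  move: nS jS; rewrite (split_nested fL CL) // (split_join fL CL) // => /andP[n1 n2] jS.
  rewrite /nested_below n1 n2 S1C S2L /=.
  by split; apply/implyP => b1; case/andP: (implyP jS b1).
have S1G := nested_sub n1; have S2G := nested_sub n2.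
rewrite (split_fst fL CL) // (split_snd fL CL) // eqxx; split=> //.
rewrite /nested_below (split_nested fL CL) // n1 n2 (split_join fL CL) //=.
rewrite subUset !(subset_trans s1, subset_trans s2) ?powersetS //=.
by apply/implyP => b1; rewrite (implyP j1 b1) (implyP j2 b1).
Qed.

Lemma nested_sum_partition L : flat L ->
  nested_sum false L = \sum_(K : {set E} | flat K && (K \subset L)) nested_sum true K.
Proof.
move=> fL; rewrite /nested_sum (partition_big join (fun K => flat K && (K \subset L))) /=.
  apply: eq_bigr => K /andP[fK sKL]; apply: eq_bigl => S.
  have [JS|nJS] := eqVneq (join S) K; last first.
    by rewrite andbF /nested_below (negPf nJS) !andbF.
  have sK : S \subset powerset K.
    by apply/subsetP => X XS; rewrite powersetE -JS join_ub.
  by rewrite /nested_below JS eqxx sK (subset_trans sK) ?powersetS //= andbT.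
move=> S /and3P[_ sS _]; rewrite join_flat; apply: join_lub => // X /(subsetP sS).
by rewrite powersetE.
Qed.

(** Grouping by join: a nested set below [C] that omits [C] cannot have join [C], so its join is a
    proper subflat. *)
Lemma nested_sum_join (f : {set E} -> {poly int}) C : C \in G ->
  \sum_(S | [&& nested M G S, S \subset powerset C & C \notin S])
     f (join S) * nested_weight S =
  \sum_(K : {set E} | flat K && (K \proper C)) f K * nested_sum true K.
Proof.
move=> CG; have fC := building_flat G_building CG.
rewrite (partition_big join (fun K => flat K && (K \proper C))) /=.
  apply: eq_bigr => K /andP[fK pKC]; rewrite /nested_sum big_distrr /=.
  apply: eq_big => [S|S /andP[_ /eqP->]//].
  have [JS|nJS] := eqVneq (join S) K; last first.
    by rewrite andbF /nested_below (negPf nJS) !andbF.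
  have sK : S \subset powerset K.
    by apply/subsetP => X XS; rewrite powersetE -JS join_ub.
  rewrite /nested_below JS eqxx sK (subset_trans sK) ?powersetS ?proper_sub //=.
  rewrite !andbT; apply: andb_idr => _; apply/negP => CS.
  have := subsetP sK C CS; rewrite powersetE => sCK.
  by rewrite properE sCK andbF in pKC.
move=> S /and3P[nS sS CS]; rewrite join_flat properEneq.
rewrite (nested_join_neq M_loopless G_building nS) //=.
by apply: join_lub => // X /(subsetP sS); rewrite powersetE.
Qed.

(** [C] is comparable with every element of [S], so it belongs to no antichain of two or more
    elements. *)
Lemma nested_insert C S : C \in G -> S \subset powerset C ->
  nested M G (C |: S) = nested M G S.
Proof.
move=> CG sS; apply/idP/idP => [|nS]; first by apply: nestedS; apply: subsetUr.
rewrite /nested subUset sub1set CG (nested_sub nS) /=.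
apply/forallP => A; apply/implyP => /and3P[sA A2 aA].
have [CA|CA] := boolP (C \in A).
  have : (0 < #|A :\ C|)%N by rewrite (cardsD1 C A) CA in A2.
  rewrite card_gt0 => /set0Pn[Y /setD1P[nYC YA]].
  have := implyP (forall_inP (forall_inP aA Y YA) C CA) nYC; rewrite /incomparable.
  have := subsetP sA Y YA; rewrite !inE (negPf nYC) /= => /(subsetP sS).
  by rewrite powersetE => ->.
have sAS : A \subset S.
  apply/subsetP => X XA; have := subsetP sA X XA; rewrite !inE => /orP[/eqP XC|//].
  by rewrite -XC XA in CA.
by have /andP[_ /forallP/(_ A)/implyP] := nS; rewrite sAS A2 aA; apply.
Qed.

(** Removing [C] leaves the other weights unchanged, and the supremum below [C] is the join of what
    remains. *)
Lemma nested_sum_top C : C \in G ->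
  \sum_(S | [&& nested M G S, S \subset powerset C & C \in S]) nested_weight S =
  \sum_(K : {set E} | flat K && (K \proper C)) w C K * nested_sum true K.
Proof.
move=> CG; rewrite -nested_sum_join //.
rewrite (reindex_onto (fun S => C |: S) (fun S => S :\ C)) /=; last first.
  by move=> S /and3P[_ _ CS]; rewrite setD1K.
have e S : ((C |: S) :\ C == S) = (C \notin S).
  by apply/eqP/idP => [<-|CS]; [rewrite setD11 | rewrite setU1K].
have sub S : (C |: S \subset powerset C) = (S \subset powerset C).
  by rewrite subUset sub1set powersetE subxx.
apply: eq_big => [S|S]; rewrite e sub.
  rewrite setU11 andbT -andbA; case sS: (S \subset powerset C); rewrite ?andbF //=.
  by rewrite nested_insert.
move=> /andP[/and3P[_ sS _] CS]; rewrite /nested_weight big_setU1 //=.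
have sub_C X : X \in S -> X \proper C.
  move=> XS; rewrite properEneq; have := subsetP sS X XS; rewrite powersetE => ->.
  by rewrite andbT; apply: contraNneq CS => <-.
congr (w C _ * _).
  congr (join _); apply/setP => X; rewrite !inE.
  have [->|_] /= := eqVneq X C; first by rewrite properxx (negPf CS).
  by apply: andb_idr => /sub_C.
apply: eq_bigr => F FS; congr (w F (join _)); apply/setP => X; rewrite !inE.
have [->|//] := eqVneq X C; rewrite (negPf CS) /=.
by have := sub_C F FS; rewrite !properE => /andP[_ /negPf->].
Qed.

(** A nested set below [C] has join [C] exactly when it contains [C]. *)
Lemma nested_sum_true_building C : C \in G ->
  nested_sum true C = \sum_(K : {set E} | flat K && (K \proper C)) w C K * nested_sum true K.
Proof.
move=> CG; have fC := building_flat G_building CG.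
rewrite -nested_sum_top //; apply: eq_bigl => S; rewrite /nested_below /=.
case nS: (nested M G S) => //=; case sS: (S \subset powerset C) => //=.
apply/eqP/idP => [JS|CS].
  by apply: contraT => /(nested_join_neq M_loopless G_building nS (subxx S) CG); rewrite JS eqxx.
by apply: join_eq => //; [move=> X /(subsetP sS); rewrite powersetE | apply: join_ub].
Qed.

(** The summand 1 accounts for the sets without [C], the summand [w C K] for those with [C], where
    [K] is the join of the other elements. *)
Lemma nested_sum_false_building C : C \in G ->
  nested_sum false C =
  \sum_(K : {set E} | flat K && (K \proper C)) (1 + w C K) * nested_sum true K.
Proof.
move=> CG; under [RHS]eq_bigr do rewrite mulrDl.
rewrite big_split /= -nested_sum_top // -(nested_sum_join (fun=> 1)) //.
rewrite /nested_sum (bigID (fun S : {set {set E}} => C \notin S)) /=.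
congr (_ + _); last by apply: eq_bigl => S; rewrite /nested_below /= andbT negbK andbA.
by apply: eq_big => [S|S _]; rewrite ?mul1r // /nested_below /= andbT andbA.
Qed.

Lemma nested_sum0 b : nested_sum b set0 = 1.
Proof.
rewrite /nested_sum (big_pred1 set0) => [|S].
  by rewrite /nested_weight big_set0.
rewrite /nested_below powerset0 /=; apply/and3P/eqP => [[nS sS _]|->].
  apply/eqP; rewrite -subset0; apply/subsetP => X XS.
  have := subsetP sS X XS; rewrite inE => /eqP X0.
  have := building_neq0 G_building (subsetP (nested_sub nS) X XS).
  by rewrite X0 eqxx.
split; [|by rewrite sub0set|by rewrite join0 ?eqxx ?implybT].
apply/andP; split; first by rewrite sub0set.
apply/forallP => A; apply/implyP => /and3P[]; rewrite subset0 => /eqP->.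
by rewrite cards0.
Qed.

End Weight.

Lemma truncated_geometricE c : (0 < c)%N ->
  1 + truncated_geometric c = \sum_(i < c) 'X^i.
Proof.
by move=> c_gt0; rewrite -(big_mkord predT (fun i => 'X^i)) big_ltn // expr0.
Qed.

Local Notation wt := (fun F K => truncated_geometric (rk F - rk K)).
Local Notation wc := (fun F K => reduced_characteristic_poly (minor M F K)).

(** Induction on the size of [L]. For [L] in [G], the geometric sums are expanded and the summations
    exchanged; the inner sum at [H] is then N([H]), to which induction applies. Otherwise both sides
    factor through a proper factor [C] and its complement. *)
Theorem nested_sum_eq L : flat L -> nested_sum wt false L = nested_sum wc true L.
Proof.
have [k leL] := ubnP #|L|; elim: k => // k IHk in L leL * => fL.
have [->|L0] := eqVneq L set0; first by rewrite !nested_sum0.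
have IH K : flat K -> K \proper L -> nested_sum wt false K = nested_sum wc true K.
  by move=> fK pKL; apply: IHk => //; apply: leq_trans (proper_card pKL) _; rewrite -ltnS.
have [LG|LG] := boolP (L \in G).
  rewrite nested_sum_false_building // nested_sum_true_building //.
  transitivity (\sum_(K : {set E} | flat K && (K \proper L))
      \sum_(H : {set E} | [&& flat H, K \subset H & H \proper L])
         wc L H * nested_sum wt true K).
    apply: eq_bigr => K /andP[fK pKL]; rewrite -mulr_suml; congr (_ * _).
    rewrite sum_reduced_characteristic_poly ?proper_sub // truncated_geometricE //.
    (* [truncated_geometricE] needs a positive exponent: a flat properly inside [L] has smaller
       rank. *)
    rewrite subn_gt0 ltnNge; apply/negP => rL.
    by have := pKL; rewrite (flat_eq fK (proper_sub pKL) rL) properxx.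
  rewrite (exchange_big_dep (fun H => flat H && (H \proper L))) /=; last first.
    by move=> K H _ /and3P[-> _ ->].
  apply: eq_bigr => H /andP[fH pHL]; rewrite -IH // nested_sum_partition // mulr_sumr.
  apply: eq_bigl => K; rewrite fH pHL andbT /=; apply/andP/andP => [[/andP[-> _] ->]//|[fK sKH]].
  by rewrite fK sKH (sub_proper_trans sKH pHL).
have [C CL] : exists C, C \in factors G L.
  apply/set0Pn; apply: contra L0 => /eqP f0.
  by rewrite -(join_factors G_building fL) f0 join0.
have [CG sCL _] := factorsP CL.
have pCL : C \proper L by rewrite properEneq sCL andbT; apply: contraNneq LG => <-.
have fC := building_flat G_building CG.
rewrite !(nested_sum_factor _ _ fL CL) !IH ?join_flat //.
(* The complement is a proper subflat because it is disjoint from the nonempty [C]. *)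
rewrite properEneq cofactor_sub // andbT; apply/eqP => LE.
have := cofactor_disjoint M_loopless G_building fL CL; rewrite LE (setIidPl sCL) => C0.
by have := building_neq0 G_building CG; rewrite C0 eqxx.
Qed.

Lemma nested_hilbert_sum : nested_hilbert M G = nested_sum wt false setT.
Proof.
by apply: eq_bigl => S; rewrite /nested_below powersetT subsetT andbT.
Qed.

End NestedSums.

Theorem theorem1p3 (E : finType) (M : polymatroid E) (G : {set {set E}})
    (E_nonempty : (0 < #|E|)%N) (M_loopless : loopless M)
    (G_building : building_set M G) :
  exists2 H : nat -> nat, hilbert_series M G H &
    forall i : nat,
      (H i)%:Z =
      (\sum_(S : {set {set E}} | nested M G S && spanning M S)
         \prod_(F in S) reduced_characteristic_poly (minor M F (sup_below M S F)))`_i.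
Proof.
have [H hH HE] := chow_hilbert_nested M_loopless G_building; exists H => // i.
rewrite HE nested_hilbert_sum // nested_sum_eq ?flatT //; congr (polyseq _)`_i.
by apply: eq_bigl => S; rewrite /nested_below powersetT subsetT.
Qed.
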